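(* Let $d\ge4$. Suppose $(E;m_2)$ is a bigraded connected algebra $E=\bigoplus_{p\ge0}E^p$, $E^p=\bigoplus_jE^p_j$, starting with $E^1=E^1_1$, $E^2=E^2_d\oplus E^2_{d+1}$, $E^3=E^3_{2d}$, and satisfying $E^{3n+i}=E^iE^{3n}=E^{3n}E^i$ for all $n\ge1$ and $i=1,2,3$. Let $(E;m_2,m_d)$ and $(E;m_2,m_{d+1})$ be two single $A_\infty$-algebras such that (1) the nonzero actions of $m_d$ are only on $(E^{[1]})^{\otimes d}$ and on the tensor products (in any order) of $d-1$ factors $E^{[1]}$ and one factor $E^{[2]}_{(d+1)}$; (2) the nonzero actions of $m_{d+1}$ are only on $(E^{[1]})^{\otimes (d+1)}$ and on the tensor products (in any order) of $d$ factors $E^{[1]}$ and one factor $E^{[2]}_{(d)}$. Suppose that $m_d$ and $m_{d+1}$ satisfy, on $(E^1)^{\otimes 2d}$, $$\sum_{i+j=d-1}(-1)^{i+(d+1)j}m_d(1^{\otimes i}\otimes m_{d+1}\otimes1^{\otimes j})+\sum_{i+j=d}(-1)^{i+dj}m_{d+1}(1^{\otimes i}\otimes m_d\otimes1^{\otimes j})=0.$$ Then $(E;m_2,m_d,m_{d+1})$ is a truncated $A_\infty$-algebra.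
   Context: Work over a fixed field $\mathbb F$. An $A_\infty$-algebra is a $\mathbb Z$-graded vector space $E$ with linear maps $m_n:E^{\otimes n}\to E$ of degree $2-n$ ($n\ge1$) such that for all $n\ge1$, $\sum(-1)^{i+jt}m_{i+1+j}(1^{\otimes i}\otimes m_t\otimes 1^{\otimes j})=0$, the sum over $n=i+t+j$, $i,j\ge0$, $t\ge1$. All $A_\infty$-algebras are strictly unital ($1\in E$ is a two-sided unit for $m_2$, and $m_n(x_1,\dots,x_n)=0$ for $n\ne2$ if some $x_i=1$). When $E$ is bigraded, every $m_n$ preserves the lower grading $j$. Writing $(E;m_a,m_b,\dots)$ means that all multiplications not listed are zero. Products $E^iE^j$ denote $m_2(E^i\otimes E^j)$. Notation: $E^{[r]}=\bigoplus_{k\ge0}E^{3k+r}$ for $r=0,1,2$; $E^{[2]}_{(d)}=\bigoplus_k E^{3k+2}_{2dk+d}$, $E^{[2]}_{(d+1)}=\bigoplus_kE^{3k+2}_{2dk+d+1}$. Single: an $A_\infty$-algebra with $m_1=0$ and only one non-trivial higher multiplication $m_p$ ($p\ge3$), i.e. $m_n=0$ for $n\notin\{2,p\}$ (a $(2,p)$-algebra). Truncated: the $A_\infty$-algebra $(E;m_2,m_d,m_{d+1})$ is truncated if its multiplications vanish on tensor products of the pieces $E^{[0]},E^{[1]},E^{[2]}_{(d)},E^{[2]}_{(d+1)}$ except possibly on the following (all permutations of factors included), with values in the indicated piece: $m_2$: $E^{[0]}E^{[0]}\to E^{[0]}$; $E^{[0]}E^{[1]}$ and $E^{[2]}_{(d)}E^{[2]}_{(d+1)}\to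 E^{[1]}$; $E^{[0]}E^{[2]}\to E^{[2]}$. $m_d$: ($d-1$ factors $E^{[1]}$, one factor $E^{[2]}_{(d+1)}$) $\to E^{[0]}$; ($d$ factors $E^{[1]}$) $\to E^{[2]}$. $m_{d+1}$: ($d$ factors $E^{[1]}$, one factor $E^{[2]}_{(d)}$) $\to E^{[0]}$; ($d+1$ factors $E^{[1]}$) $\to E^{[2]}$. *)

(* Defs.v *)
From HB Require Import structures.
From mathcomp Require Import all_boot all_order all_algebra.
From Stdlib Require List.
Set Implicit Arguments.
Unset Strict Implicit.
Unset Printing Implicit Defensive.
Import Order.TTheory GRing.Theory Num.Theory.
Local Open Scope ring_scope.

Section Subspaces.
Variables (F : fieldType) (V : lmodType F).

Definition subspace (P : V -> Prop) : Prop :=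
  P 0 /\ forall (a : F) (u v : V), P u -> P v -> P (a *: u + v).

Definition same_space (P Q : V -> Prop) : Prop := forall v, P v <-> Q v.

Definition zero_space (v : V) : Prop := v = 0.

Definition line (u v : V) : Prop := exists a : F, v = a *: u.

Definition add_space (P Q : V -> Prop) (v : V) : Prop :=
  exists u w, [/\ P u, Q w & v = u + w].

Definition sum_space (I : eqType) (H : I -> V -> Prop) (v : V) : Prop :=
  exists (s : seq I) (f : I -> V),
    (forall i, i \in s -> H i (f i)) /\ v = \sum_(i <- s) f i.

Definition direct_sum (I : eqType) (H : I -> V -> Prop) : Prop :=
  [/\ forall i, subspace (H i),
      forall v, sum_space H v
    & forall (s : seq I) (f : I -> V),
        uniq s -> (forall i, i \in s -> H i (f i)) ->
        \sum_(i <- s) f i = 0 -> forall i, i \in s -> f i = 0].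

(* The span of the products x y with x in P and y in Q, i.e. the image of
   P (x) Q under the product. *)
Definition prod_space (mul : V -> V -> V) (P Q : V -> Prop) (v : V) : Prop :=
  exists s : seq (V * V),
    (forall u, u \in s -> P u.1 /\ Q u.2) /\
    v = \sum_(u <- s) mul u.1 u.2.

End Subspaces.

Section AInfinity.
Variables (F : fieldType) (V : lmodType F).

(* A family of maps m_n : V^{(x) n} -> V, n >= 1, is encoded as one function
   m : seq V -> V, with m_n (x_1 (x) ... (x) x_n) = m [:: x_1; ...; x_n].
   The value m [::] is never used. *)

Definition multilinear (m : seq V -> V) : Prop :=
  forall (s1 s2 : seq V) (a : F) (u v : V),
    m (s1 ++ (a *: u + v) :: s2) = a *: m (s1 ++ u :: s2) + m (s1 ++ v :: s2).

(* m_n has degree k n with respect to the grading U. *)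
Definition of_degree (U : int -> V -> Prop) (k : nat -> int)
    (m : seq V -> V) : Prop :=
  forall (ps : seq int) (s : seq V),
    (0 < size s)%N -> List.Forall2 U ps s ->
    U (\sum_(p <- ps) p + k (size s)) (m s).

(* The value of (-1)^(i + j t) m_(i+1+j) (1^{(x) i} (x) m_t (x) 1^{(x) j}) on
   homogeneous elements s of degrees ps, with size s = i + t + j.  The exponent
   (2 - t) (p_1 + ... + p_i) is the Koszul sign: m_t has degree 2 - t and is
   moved past the first i arguments. *)
Definition stasheff_term (m : seq V -> V) (ps : seq int) (s : seq V)
    (i t j : nat) : V :=
  ((-1 : F) ^ ((i + j * t)%N%:Z + (2 - t%:Z) * \sum_(p <- take i ps) p)) *:
    m (take i s ++ m (take t (drop i s)) :: drop (i + t) s).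

Definition stasheff (U : int -> V -> Prop) (m : seq V -> V) : Prop :=
  forall (ps : seq int) (s : seq V),
    (0 < size s)%N -> List.Forall2 U ps s ->
    \sum_(0 <= i < size s) \sum_(1 <= t < (size s - i).+1)
      stasheff_term m ps s i t (size s - i - t) = 0.

Definition strictly_unital (one : V) (m : seq V -> V) : Prop :=
  (forall x, m [:: one; x] = x /\ m [:: x; one] = x) /\
  (forall s, size s <> 2%N -> List.In one s -> m s = 0).

Record ainf_algebra (U : int -> V -> Prop) (one : V) (m : seq V -> V) : Prop :=
  AinfAlgebra {
    ainf_graded : direct_sum U;
    ainf_linear : multilinear m;
    ainf_degree : of_degree U (fun n => 2 - n%:Z) m;
    ainf_stasheff : stasheff U m;
    ainf_unital : strictly_unital one m
  }.

(* A bigrading is a family G with G i j = E^i_j. *)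

Definition bigrading (G : int -> int -> V -> Prop) : Prop :=
  direct_sum (fun ij : int * int => G ij.1 ij.2).

Definition upper (G : int -> int -> V -> Prop) (i : int) : V -> Prop :=
  sum_space (fun j : int => G i j).

Definition lower (G : int -> int -> V -> Prop) (j : int) : V -> Prop :=
  sum_space (fun i : int => G i j).

Record bigraded_ainf (G : int -> int -> V -> Prop) (one : V)
    (m : seq V -> V) : Prop := BigradedAinf {
  bigraded_ainf_grading : bigrading G;
  bigraded_ainf_ainf : ainf_algebra (upper G) one m;
  bigraded_ainf_lower : of_degree (lower G) (fun=> 0) m
}.

Definition binary (m : seq V -> V) (x y : V) : V := m [:: x; y].

(* The multiplications of (E; m_a, m_b, ...), where ns = [:: a; b; ...]. *)
Definition only (ns : seq nat) (m : seq V -> V) (s : seq V) : V :=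
  if size s \in ns then m s else 0.

Record single_ainf (p : nat) (G : int -> int -> V -> Prop) (one : V)
    (m : seq V -> V) : Prop := SingleAinf {
  single_arity : (3 <= p)%N;
  single_ainf_ainf : bigraded_ainf G one m;
  single_zero : forall s, (0 < size s)%N -> size s \notin [:: 2%N; p] -> m s = 0
}.

Record bigraded_connected_algebra (G : int -> int -> V -> Prop) (one : V)
    (mul : V -> V -> V) : Prop := BigradedConnectedAlgebra {
  bca_grading : bigrading G;
  bca_linearl : forall (a : F) x x' y, mul (a *: x + x') y = a *: mul x y + mul x' y;
  bca_linearr : forall (a : F) x y y', mul x (a *: y + y') = a *: mul x y + mul x y';
  bca_assoc : forall x y z, mul x (mul y z) = mul (mul x y) z;
  bca_one : forall x, mul one x = x /\ mul x one = x;
  bca_degree : forall i j k l x y,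
    G i j x -> G k l y -> G (i + k) (j + l) (mul x y);
  bca_nneg : forall i : int, i < 0 -> same_space (upper G i) (@zero_space F V);
  bca_one_neq0 : one <> 0;
  bca_connected : same_space (upper G 0) (line one)
}.

(* E^{[r]} is residue_space G r. *)
Definition residue_space (G : int -> int -> V -> Prop) (r : nat) : V -> Prop :=
  sum_space (fun k : nat => upper G (3 * k + r)%N%:Z).

(* E^{[2]}_{(c)} for c = d, d + 1; d enters through the lower degree 2dk + c. *)
Definition residue2_space (G : int -> int -> V -> Prop) (d c : nat) : V -> Prop :=
  sum_space (fun k : nat => G (3 * k + 2)%N%:Z (2 * d * k + c)%N%:Z).

End AInfinity.

(* Names of the pieces E^{[0]}, E^{[1]}, E^{[2]}_{(d)}, E^{[2]}_{(d+1)}. *)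
Variant piece := P0 | P1 | P2d | P2d1.

Lemma piece_eq_dec : comparable piece.
Proof. by case; case; (by left) || (by right). Qed.

HB.instance Definition _ := hasDecEq.Build piece (compareP piece_eq_dec).

Section Truncated.
Variables (F : fieldType) (V : lmodType F).

Definition piece_space (G : int -> int -> V -> Prop) (d : nat) (c : piece) :
    V -> Prop :=
  match c with
  | P0 => residue_space G 0
  | P1 => residue_space G 1
  | P2d => residue2_space G d d
  | P2d1 => residue2_space G d d.+1
  end.

(* m_n vanishes on every tensor product of n pieces that is not, up to the
   order of the factors, one of the words in ws. *)
Definition acts_only_on (G : int -> int -> V -> Prop) (d : nat)
    (m : seq V -> V) (n : nat) (ws : seq (seq piece)) : Prop :=
  forall (cs : seq piece) (s : seq V),
    size s = n -> List.Forall2 (piece_space G d) cs s ->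
    ~~ has (perm_eq cs) ws -> m s = 0.

(* A pair (w, r) allows the product of the pieces listed in w, in any order, to
   be nonzero, with values in E^{[r]}; it concerns m_n with n = size w. *)
Definition truncated_rules (d : nat) : seq (seq piece * nat) :=
  [:: ([:: P0; P0], 0%N);
      ([:: P0; P1], 1%N);
      ([:: P2d; P2d1], 1%N);
      ([:: P0; P2d], 2%N);
      ([:: P0; P2d1], 2%N);
      (rcons (nseq d.-1 P1) P2d1, 0%N);
      (nseq d P1, 2%N);
      (rcons (nseq d P1) P2d, 0%N);
      (nseq d.+1 P1, 2%N)].

Record truncated_ainf (d : nat) (G : int -> int -> V -> Prop) (one : V)
    (m : seq V -> V) : Prop := TruncatedAinf {
  truncated_ainf_ainf : bigraded_ainf G one m;
  truncated_arity : forall s, (0 < size s)%N ->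
    size s \notin [:: 2%N; d; d.+1] -> m s = 0;
  truncated_vanish : forall n, (0 < n)%N ->
    acts_only_on G d m n (unzip1 (truncated_rules d));
  truncated_values : forall w r cs s, (w, r) \in truncated_rules d ->
    perm_eq cs w -> List.Forall2 (piece_space G d) cs s ->
    residue_space G r (m s)
}.

End Truncated.

(* Main.v *)
Require Import Defs.
From mathcomp Require Import all_boot all_order all_algebra zify.
From Stdlib Require List.
Import Order.TTheory GRing.Theory Num.Theory.
Local Open Scope ring_scope.
Set Implicit Arguments.
Unset Strict Implicit.
Unset Printing Implicit Defensive.

(* The arities 3, d + 1, d + 2, 2d - 1, 2d, 2d + 1 of the Stasheff identities in
   which two of m_2, m_d, m_(d+1) are composed are distinct for d >= 4, so only
   the identity of arity 2d is new.  Counting degrees modulo 3, all its terms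
   vanish unless every argument lies in E^[1].  Since m_d and m_(d+1) vanish as
   soon as an argument a lies in E^{3k}, their own Stasheff identities with m_2
   say that a can be moved from one argument to the next.  The arity 2d identity
   inherits this, and as E^{3k+1} = E^1 E^{3k}, it reduces to its restriction to
   E^1. *)

(** The degree count works because $p \mapsto p-1$ modulo 3 absorbs the arity: $n$ inputs and the
    degree $2-n$ of $m_n$ cancel, so every multiplication raises the total class by the same amount,
    1. Operations that are nonzero only in total class 0 or 1 can then be composed only if all
    classes are 0. The delicate point in moving [a] is the Koszul sign. When [a] passes from in
    front of the inner operation into its block, the inner operation no longer moves past [a]; the
    sign lost is exactly the one in the arity $n+1$ identity with [a] in first position. The motion
    goes to the right because $E^{3k}$ is the right-hand factor of $E^1E^{3k}$ and because [a]
    leaves the last argument through $m_2$ without any sign. At that stage the merged operation is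
    not known to be an $A_\infty$-structure, so the rules for moving [a] are isolated as properties
    of a bare operation. For $d=3$ the arities $d+2$ and $2d-1$ coincide, and identities of the two
    given structures would mix. *)

(** * Multilinear maps on spans, and the shape of Stasheff sums *)

Section Multilinear.
Variables (F : fieldType) (V : lmodType F).
Implicit Types (f : seq V -> V) (s : seq V) (P : V -> Prop).

Lemma subspace_sum P : subspace P -> forall vs : seq V,
  (forall v, v \in vs -> P v) -> P (\sum_(v <- vs) v).
Proof.
move=> [P0 PD]; elim=> [|v vs IHvs] Pvs; first by rewrite big_nil.
rewrite big_cons -[v]scale1r; apply: PD; first by apply: Pvs; rewrite mem_head.
by apply: IHvs => u uvs; apply: Pvs; rewrite in_cons uvs orbT.
Qed.

Lemma multilinear0 f s1 s2 : multilinear f -> f (s1 ++ 0 :: s2) = 0.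
Proof.
by move=> f_lin; have := f_lin s1 s2 (-1) 0 0; rewrite scaler0 addr0 scaleN1r addNr.
Qed.

Lemma multilinear_sum f s1 s2 (vs : seq V) : multilinear f ->
  f (s1 ++ (\sum_(v <- vs) v) :: s2) = \sum_(v <- vs) f (s1 ++ v :: s2).
Proof.
move=> f_lin; elim: vs => [|v vs IHvs]; first by rewrite !big_nil multilinear0.
by rewrite !big_cons -[v in LHS]scale1r f_lin scale1r IHvs.
Qed.

Lemma multilinearZ f s1 s2 a v : multilinear f ->
  f (s1 ++ (a *: v) :: s2) = a *: f (s1 ++ v :: s2).
Proof. by move=> f_lin; rewrite -[a *: v]addr0 f_lin multilinear0 ?addr0. Qed.

(** The additive closure of an arbitrary predicate. Unlike [sum_space] it carries no index, so [P]
    can be an existential or a disjunction; the empty list covers components that vanish, such as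
    those of negative degree. *)
Definition sum_of (P : V -> Prop) (v : V) : Prop :=
  exists vs : seq V, (forall u, u \in vs -> P u) /\ v = \sum_(u <- vs) u.

Lemma sum_ofW (P : V -> Prop) v : P v -> sum_of P v.
Proof.
move=> Pv; exists [:: v]; split; last by rewrite big_seq1.
by move=> u; rewrite inE => /eqP ->.
Qed.

Lemma sum_of_bind (P Q : V -> Prop) v :
  sum_of P v -> (forall u, P u -> sum_of Q u) -> sum_of Q v.
Proof.
move=> [vs [Pvs ->]] PQ; elim: vs Pvs => [|u vs IHvs] Pvs.
  by exists [::]; rewrite big_nil.
have [us1 [Qus1 e1]] := PQ u (Pvs u (mem_head _ _)).
have [|us2 [Qus2 e2]] := IHvs; first by move=> w wvs; apply: Pvs; rewrite inE wvs orbT.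
exists (us1 ++ us2); rewrite big_cons big_cat -e1 -e2; split=> // w.
by rewrite mem_cat => /orP[/Qus1|/Qus2].
Qed.

Lemma sum_space_sum_of (I : eqType) (H : I -> V -> Prop) v :
  sum_space H v -> sum_of (fun u => exists i, H i u) v.
Proof.
move=> [s [f [Hf ->]]]; exists [seq f i | i <- s]; split; last by rewrite big_map.
by move=> u /mapP[i /Hf Hi ->]; exists i.
Qed.

Lemma sum_spaceW (I : eqType) (H : I -> V -> Prop) i v : H i v -> sum_space H v.
Proof.
move=> Hv; exists [:: i], (fun=> v); rewrite big_seq1; split=> // j.
by rewrite inE => /eqP ->.
Qed.

(** Reduction principle: by multilinearity a closed property of [f s] need only be checked when
    every argument is one of the generators [Q']. The prefix [pre] in the proof holds the arguments
    already replaced. *)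
Lemma multilinear_closed (T : Type) (Q Q' : T -> V -> Prop) P f (cs : seq T) s :
    multilinear f -> subspace P ->
    (forall c v, Q c v -> sum_of (Q' c) v) ->
    (forall s', List.Forall2 Q' cs s' -> P (f s')) ->
  List.Forall2 Q cs s -> P (f s).
Proof.
move=> f_lin P_sub QQ' Pf Qs.
suff gen pre : (forall s', List.Forall2 Q' cs s' -> P (f (pre ++ s'))) ->
  P (f (pre ++ s)) by apply: (gen [::]).
elim: Qs pre {Pf} => [|c v {}cs {}s Qv _ IHs] pre Pf; first exact: Pf.
have [vs [Q'vs ->]] := QQ' _ _ Qv; rewrite multilinear_sum //.
rewrite -(big_map (fun v => f (pre ++ v :: s)) xpredT id).
apply: subspace_sum => // _ /mapP[u uvs ->].
rewrite -cat_rcons; apply: IHs => s' Q's'; rewrite cat_rcons.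
by apply: Pf; constructor=> //; apply: Q'vs.
Qed.

Lemma stasheff_term_split f (psA psR : seq int) A B C j : size psA = size A ->
  stasheff_term f (psA ++ psR) (A ++ B ++ C) (size A) (size B) j =
  ((-1 : F) ^ ((size A + j * size B)%N%:Z +
     (2 - (size B)%:Z) * \sum_(p <- psA) p)) *: f (A ++ f B :: C).
Proof.
move=> sz; rewrite /stasheff_term take_size_cat ?sz // -sz take_size_cat // sz.
by rewrite drop_size_cat // take_size_cat // catA drop_size_cat // size_cat.
Qed.


(** The cut into prefix, inner block and suffix depends on the position of the slot only. The pieces
    are therefore chosen before [x], so that one cut serves all the vectors compared in a linearity
    statement. *)
Lemma take_drop_slot s1 s2 i t : [\/
  exists A1 A2 B C, forall x : V, [/\ take i (s1 ++ x :: s2) = A1 ++ x :: A2,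
    take t (drop i (s1 ++ x :: s2)) = B & drop (i + t) (s1 ++ x :: s2) = C],
  exists A B1 B2 C, forall x : V, [/\ take i (s1 ++ x :: s2) = A,
    take t (drop i (s1 ++ x :: s2)) = B1 ++ x :: B2
    & drop (i + t) (s1 ++ x :: s2) = C]
| exists A B C1 C2, forall x : V, [/\ take i (s1 ++ x :: s2) = A,
    take t (drop i (s1 ++ x :: s2)) = B
    & drop (i + t) (s1 ++ x :: s2) = C1 ++ x :: C2]].
Proof.
case: (ltnP (size s1) i) => [lt1i|lei1].
  constructor 1; exists s1, (take (i - size s1).-1 s2).
  exists (take t (drop (i - size s1).-1 s2)), (drop (i + t - size s1).-1 s2) => x.
  rewrite take_cat !drop_cat.
  have -> : (i < size s1)%N = false by lia.
  have -> : (i + t < size s1)%N = false by lia.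
  have -> : (i - size s1 = (i - size s1).-1.+1)%N by lia.
  by have -> : (i + t - size s1 = (i + t - size s1).-1.+1)%N by lia.
rewrite -[s1](cat_take_drop i); move: (take i s1) (size_takel lei1) => A szA.
move: (drop i s1) => {lei1}s1.
have E x : [/\ take i ((A ++ s1) ++ x :: s2) = A,
    take t (drop i ((A ++ s1) ++ x :: s2)) = take t (s1 ++ x :: s2)
  & drop (i + t) ((A ++ s1) ++ x :: s2) = drop t (s1 ++ x :: s2)].
  by rewrite -catA -szA take_size_cat // drop_size_cat // addnC -drop_drop drop_size_cat.
case: (ltnP (size s1) t) => [lt1t|let1].
  constructor 2; exists A, s1, (take (t - size s1).-1 s2), (drop (t - size s1).-1 s2) => x.
  have [-> -> ->] := E x; rewrite take_cat drop_cat.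
  have -> : (t < size s1)%N = false by lia.
  by have -> : (t - size s1 = (t - size s1).-1.+1)%N by lia.
constructor 3; exists A, (take t s1), (drop t s1), s2 => x.
have [-> -> ->] := E x; rewrite takel_cat //; split=> //.
by rewrite -[s1 in LHS](cat_take_drop t) -catA drop_size_cat ?size_takel.
Qed.

(** With [ps] held fixed the sign is a constant, so linearity holds on all words, whether or not
    their letters have the degrees [ps]. *)
Lemma multilinear_stasheff_term f ps i t j :
  multilinear f -> multilinear (fun s => stasheff_term f ps s i t j).
Proof.
move=> f_lin s1 s2 a u v; rewrite /stasheff_term.
set e := (_ ^ _); rewrite scalerA mulrC -scalerA -scalerDr; congr (_ *: _).
have [] := take_drop_slot s1 s2 i t; move=> [X1 [X2 [X3 [X4 E]]]];
  have [-> -> ->] := E (a *: u + v); have [-> -> ->] := E u;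
  have [-> -> ->] := E v.
- by rewrite -!catA /= f_lin.
- by rewrite f_lin f_lin.
- by rewrite -!cat_cons !catA f_lin.
Qed.


Lemma sum_nat_at1 (G : nat -> V) m k n : (m <= k < n)%N ->
    (forall i, (m <= i < n)%N -> i <> k -> G i = 0) ->
  \sum_(m <= i < n) G i = G k.
Proof.
move=> lt_k G0; rewrite (bigD1_seq k) ?mem_index_iota ?iota_uniq //=.
rewrite big_nat_cond big1 ?addr0 // => i /andP[lt_i /eqP]; exact: G0.
Qed.

Lemma sum_nat_at2 (G : nat -> V) m k1 k2 n : (m <= k1 < n)%N -> (m <= k2 < n)%N ->
    k1 <> k2 -> (forall i, (m <= i < n)%N -> i <> k1 -> i <> k2 -> G i = 0) ->
  \sum_(m <= i < n) G i = G k1 + G k2.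
Proof.
move=> lt_k1 lt_k2 k12 G0.
rewrite (bigD1_seq k1) ?mem_index_iota ?iota_uniq //=; congr (_ + _).
have /eqP/negPf neq21 : k2 <> k1 by move/esym.
rewrite big_mkcond (@sum_nat_at1 _ _ k2) /= ?neq21 // => i lt_i /G0 Gi.
by case: eqP => //= ik1; apply: Gi.
Qed.

Lemma exchange_triangle N (T : nat -> nat -> V) :
  \sum_(0 <= i < N) \sum_(1 <= t < (N - i).+1) T i t =
  \sum_(1 <= t < N.+1) \sum_(0 <= i < (N - t).+1) T i t.
Proof.
under eq_big_nat => i lt_i.
  rewrite (big_nat_widen _ _ N.+1); last by lia.
  over.
rewrite (exchange_big_dep_nat xpredT) //=.
apply: eq_big_nat => t lt_t; rewrite [RHS](big_nat_widen _ _ N); last by lia.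
by rewrite big_nat_cond [RHS]big_nat_cond; apply: eq_bigl => i; lia.
Qed.

(** A Stasheff sum is regrouped by inner arity, because only two inner arities ever survive: 2 and
    $n$ in arity $n+1$, and $d$ and $d+1$ in arity $2d$. *)
Lemma sum_triangle_at2 N (T : nat -> nat -> V) t1 t2 :
    (1 <= t1 <= N)%N -> (1 <= t2 <= N)%N -> t1 <> t2 ->
    (forall i t, (i + t <= N)%N -> (0 < t)%N -> t <> t1 -> t <> t2 -> T i t = 0) ->
  \sum_(0 <= i < N) \sum_(1 <= t < (N - i).+1) T i t =
  \sum_(0 <= i < (N - t1).+1) T i t1 + \sum_(0 <= i < (N - t2).+1) T i t2.
Proof.
move=> lt_t1 lt_t2 t12 T0; rewrite exchange_triangle.
apply: (@sum_nat_at2 (fun t => \sum_(0 <= i < (N - t).+1) T i t)) => // t lt_t t1' t2'.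
by rewrite big_nat big1 // => i lt_i; apply: T0 => //; lia.
Qed.

End Multilinear.

(** * Signs with integer exponents *)

Section Signs.
Variable F : fieldType.

Lemma sign_neq0 : (-1 : F) != 0. Proof. by rewrite oppr_eq0 oner_eq0. Qed.

Lemma sign_zD (x y : int) : (-1 : F) ^ (x + y) = (-1) ^ x * (-1) ^ y.
Proof. exact: expfzDr sign_neq0. Qed.

Lemma sign_z2 (x : int) : (-1 : F) ^ (x * 2) = 1.
Proof. by rewrite mulrC -exprz_exp -exprnP sqrrN expr1n exp1rz. Qed.

Lemma sign_zz (x : int) : (-1 : F) ^ x * (-1) ^ x = 1.
Proof. by rewrite -sign_zD (_ : x + x = x * 2) ?sign_z2 //; lia. Qed.

Lemma eq_sign (x y z : int) : x = y + z * 2 -> (-1 : F) ^ x = (-1) ^ y.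
Proof. by move=> ->; rewrite sign_zD sign_z2 mulr1. Qed.

End Signs.

(** * Words of homogeneous elements *)

Section Homogeneous.
Variables (F : fieldType) (V : lmodType F) (U : int -> V -> Prop).
Implicit Types (s : seq V) (ps : seq int).

Definition homogeneous s : Prop := forall x, x \in s -> exists p, U p x.

Lemma homogeneous_cat s1 s2 :
  homogeneous (s1 ++ s2) <-> homogeneous s1 /\ homogeneous s2.
Proof.
split=> [hs|[h1 h2] x]; last by rewrite mem_cat => /orP[/h1|/h2].
by split=> x sx; apply: hs; rewrite mem_cat sx ?orbT.
Qed.

Lemma homogeneous_cons x s :
  homogeneous (x :: s) <-> (exists p, U p x) /\ homogeneous s.
Proof.
split=> [hs|[hx hs] y]; last by rewrite inE => /predU1P[->|/hs].
by split=> [|y sy]; apply: hs; rewrite inE ?eqxx ?sy ?orbT.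
Qed.

Lemma Forall2_homogeneous ps s : List.Forall2 U ps s -> homogeneous s.
Proof.
elim=> [|p x {}ps {}s Ux _ IHs] //.
by apply/homogeneous_cons; split; first by exists p.
Qed.

Lemma homogeneous_Forall2 s : homogeneous s -> exists ps, List.Forall2 U ps s.
Proof.
elim: s => [|x s IHs]; first by exists [::]; constructor.
by case/homogeneous_cons=> [[p Ux] /IHs[ps Us]]; exists (p :: ps); constructor.
Qed.

Lemma homogeneous_degree k f s : of_degree U k f -> (0 < size s)%N ->
  homogeneous s -> exists p, U p (f s).
Proof.
move=> f_deg s_gt0 /homogeneous_Forall2[ps Us].
by eexists; apply: f_deg Us.
Qed.

Lemma Forall2_size (T : Type) (Q : T -> V -> Prop) (cs : seq T) s :
  List.Forall2 Q cs s -> size cs = size s.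
Proof. by elim=> //= c v {}cs {}s _ _ ->. Qed.

Lemma Forall2_cat (T : Type) (Q : T -> V -> Prop) cs1 cs2 s1 s2 :
  List.Forall2 Q cs1 s1 -> List.Forall2 Q cs2 s2 ->
  List.Forall2 Q (cs1 ++ cs2) (s1 ++ s2).
Proof. by elim=> //= *; constructor; auto. Qed.

Lemma Forall2_cat_inv (T : Type) (Q : T -> V -> Prop) (cs : seq T) s1 s2 :
    List.Forall2 Q cs (s1 ++ s2) -> exists cs1 cs2,
  [/\ List.Forall2 Q cs1 s1, List.Forall2 Q cs2 s2 & cs = cs1 ++ cs2].
Proof.
elim: s1 cs => [|x s1 IHs] cs /= Qs; first by exists [::], cs; split=> //; constructor.
inversion_clear Qs as [|c ? cs' ? Qx Qs'].
have [cs1 [cs2 [Q1 Q2 ->]]] := IHs _ Qs'.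
by exists (c :: cs1), cs2; split=> //; constructor.
Qed.

End Homogeneous.

(* In a (2, n)-algebra whose m_n vanishes on words containing a, the Stasheff
   identity of arity n + 1 only keeps the two terms next to a. *)
Section Balanced.
Variables (F : fieldType) (V : lmodType F) (U : int -> V -> Prop) (one : V).
Variables (f : seq V -> V) (n : nat) (a : V) (q : int).
Hypothesis n_ge3 : (3 <= n)%N.
Hypothesis f_ainf : ainf_algebra U one f.
Hypothesis f_single : forall s, (0 < size s)%N -> size s \notin [:: 2%N; n] -> f s = 0.
Hypothesis Ua : U q a.
Hypothesis f_a : forall s, size s = n -> homogeneous U s -> a \in s -> f s = 0.

Lemma stasheff_single ps s : List.Forall2 U ps s -> size s = n.+1 ->
  \sum_(0 <= i < n) stasheff_term f ps s i 2 (n.+1 - i - 2) +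
  (stasheff_term f ps s 0 n 1 + stasheff_term f ps s 1 n 0) = 0.
Proof.
move=> Us sz; have := ainf_stasheff f_ainf _ Us; rewrite sz => /(_ isT).
rewrite (@sum_triangle_at2 _ _ _ _ 2 n); try lia.
  have -> : (n.+1 - 2).+1 = n by lia.
  have -> : (n.+1 - n).+1 = 2%N by lia.
  rewrite [X in _ + X]big_nat_recl // big_nat1.
  by have [-> ->] : (n.+1 - 0 - n = 1)%N /\ (n.+1 - 1 - n = 0)%N by lia.
move=> i t le_it t_gt0 t2 tn; rewrite /stasheff_term [f (take t _)]f_single.
- by rewrite multilinear0 ?scaler0 //; apply: ainf_linear f_ainf.
- by rewrite size_takel // size_drop sz; lia.
by rewrite size_takel ?size_drop ?sz ?inE; lia.
Qed.

(** The map $m_2$ has degree 0, so no Koszul sign arises, and $jt=2j$ is even: only the position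
    contributes. *)
Lemma stasheff_term2 ps A u v C j :
  stasheff_term f ps (A ++ u :: v :: C) (size A) 2 j =
  (-1) ^+ size A *: f (A ++ f [:: u; v] :: C).
Proof.
rewrite /stasheff_term subrr mul0r addr0 take_size_cat // [(_ + 2)%N]addnC -drop_drop.
rewrite drop_size_cat //= take0 drop0 -exprnP exprD [(j * 2)%N]mulnC exprM.
by rewrite sqrrN !expr1n mulr1.
Qed.

(** Here [a] has position [size L] and $m_2$ acts on positions [i] and [i.+1]. If it misses [a],
    then [a] is still an argument of the outer $m_n$. *)
Lemma stasheff_term2_eq0 ps L R i j : size (L ++ a :: R) = n.+1 ->
    homogeneous U (L ++ a :: R) -> (i < n)%N ->
    (i.+1 < size L)%N || (size L < i)%N ->
  stasheff_term f ps (L ++ a :: R) i 2 j = 0.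
Proof.
move=> sz hs lt_in iL; rewrite /stasheff_term.
set s := L ++ a :: R in sz hs *.
have szt : size (take 2 (drop i s)) = 2%N by rewrite size_takel // size_drop sz; lia.
rewrite f_a ?scaler0 //.
- by rewrite size_cat /= size_takel ?size_drop ?sz; lia.
- apply/homogeneous_cat; split; first by move=> x /mem_take; apply: hs.
  apply/homogeneous_cons; split; last by move=> x /mem_drop; apply: hs.
  apply: (homogeneous_degree (ainf_degree f_ainf)); first by rewrite szt.
  by move=> x /mem_take/mem_drop; apply: hs.
rewrite mem_cat inE; case/orP: iL => iL; apply/orP; [right|left].
  apply/orP; right; rewrite /s drop_cat; case: ltnP => _; first by rewrite mem_cat mem_head orbT.
  by rewrite (_ : (i + 2 - size L = 0)%N) ?drop0 ?mem_head //; lia.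
rewrite /s take_cat; case: ltnP => ?; first by lia.
by rewrite mem_cat (_ : (i - size L = (i - size L).-1.+1)%N) ?mem_head ?orbT //; lia.
Qed.

Lemma stasheff_termn_eq0 ps L R i j : size (L ++ a :: R) = n.+1 ->
    homogeneous U (L ++ a :: R) -> (i < 2)%N -> (i <= size L < i + n)%N ->
  stasheff_term f ps (L ++ a :: R) i n j = 0.
Proof.
move=> sz hs lt_i iL; rewrite /stasheff_term [f (take n _)]f_a.
- by rewrite multilinear0 ?scaler0 //; apply: ainf_linear f_ainf.
- by rewrite size_takel // size_drop sz; lia.
- by move=> x /mem_take/mem_drop; apply: hs.
rewrite -[L](cat_take_drop i) -catA drop_size_cat ?size_takel //; last by lia.
rewrite take_cat size_drop; case: ltnP => ?; first by lia.
rewrite mem_cat (_ : (n - (size L - i) = (n - (size L - i)).-1.+1)%N); last by lia.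
by rewrite mem_head orbT.
Qed.

(** As [a] is neither first nor last, both blocks of length $n$ contain it and both composites with
    inner $m_n$ vanish. The two products involving [a] sit at consecutive positions, hence have
    opposite signs. *)
Lemma balanced_mid s1 x y s2 : (size s1 + size s2).+2 = n ->
    homogeneous U (s1 ++ x :: a :: y :: s2) ->
  f (s1 ++ f [:: x; a] :: y :: s2) = f (s1 ++ x :: f [:: a; y] :: s2).
Proof.
move=> szn hs; have [ps Us] := homogeneous_Forall2 hs.
have sz : size (s1 ++ x :: a :: y :: s2) = n.+1 by rewrite size_cat /=; lia.
have := stasheff_single Us sz; rewrite -cat_rcons in hs sz *.
have szr : size (rcons s1 x) = (size s1).+1 by rewrite size_rcons.
rewrite !stasheff_termn_eq0 ?szr //; try lia.
rewrite !addr0 (@sum_nat_at2 _ _ _ _ (size s1) (size s1).+1); try lia; last first.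
  by move=> i lt_i neq1 neq2; apply: stasheff_term2_eq0 => //; rewrite ?szr; lia.
rewrite {1}cat_rcons stasheff_term2 -{1}szr stasheff_term2 szr cat_rcons.
rewrite exprS mulN1r scaleNr -scalerBr => /eqP.
by rewrite scaler_eq0 signr_eq0 subr_eq0 => /eqP.
Qed.

(** The initial block of length $n$ misses the final [a], so $m_2(m_n\otimes 1)$ survives; its sign
    $(-1)^n$ is opposite to that of the product of [x] and [a]. *)
Lemma balanced_last s x : (size s).+1 = n -> homogeneous U (s ++ [:: x; a]) ->
  f (s ++ [:: f [:: x; a]]) = f [:: f (s ++ [:: x]); a].
Proof.
move=> szn hs; have [ps Us] := homogeneous_Forall2 hs.
have sz : size (s ++ [:: x; a]) = n.+1 by rewrite size_cat /=; lia.
have := stasheff_single Us sz; rewrite -cat_rcons in hs sz *.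
have szr : size (rcons s x) = (size s).+1 by rewrite size_rcons.
rewrite [stasheff_term _ _ _ 1 _ _]stasheff_termn_eq0 ?szr //; try lia.
rewrite addr0 (@sum_nat_at1 _ _ _ _ (size s)); try lia; last first.
  by move=> i lt_i neq1; apply: stasheff_term2_eq0 => //; rewrite ?szr; lia.
rewrite {1}cat_rcons stasheff_term2.
have /= := @stasheff_term_split _ _ f [::] ps [::] (rcons s x) [:: a] 1%N erefl.
rewrite szr szn => ->; rewrite big_nil mulr0 addr0 add0n mul1n.
rewrite -exprnP -szn exprS mulN1r scaleNr -scalerBr => /eqP.
by rewrite scaler_eq0 signr_eq0 subr_eq0 !cats1 => /eqP.
Qed.

(** Now $m_2(1\otimes m_n)$ survives, and $m_n$, of degree $2-n$, has moved past [a], of degree $q$: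
    this is where the sign comes from. *)
Lemma balanced_head x s : (size s).+1 = n -> homogeneous U (a :: x :: s) ->
  f [:: a; f (x :: s)] = (-1) ^ ((2 - n%:Z) * q) *: f (f [:: a; x] :: s).
Proof.
move=> szn /homogeneous_cons[_ hs]; have [ps Us] := homogeneous_Forall2 hs.
have {}hs : homogeneous U ([::] ++ a :: x :: s).
  by apply/homogeneous_cons; split; first by exists q.
have sz : size ([::] ++ a :: x :: s) = n.+1 by rewrite /=; lia.
have {}Us : List.Forall2 U (q :: ps) ([::] ++ a :: x :: s) by constructor.
have := stasheff_single Us sz.
rewrite stasheff_termn_eq0 //= ?add0r; last by lia.
rewrite (@sum_nat_at1 _ _ _ _ 0%N); try lia; last first.
  by move=> i lt_i neq1; apply: (@stasheff_term2_eq0 _ [::]) => //=; lia.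
rewrite (@stasheff_term2 _ [::]) /= expr0 scale1r.
have := @stasheff_term_split _ _ f [:: q] ps [:: a] (x :: s) [::] 0%N erefl.
rewrite cats0 /= szn => ->; rewrite mul0n addn0 big_seq1 sign_zD expr1z mulN1r scaleNr.
move=> /eqP; rewrite subr_eq0 => /eqP ->.
by rewrite scalerA sign_zz scale1r.
Qed.
End Balanced.

(** * Moving a factor through a composite of two multiplications *)

Section BalancedTerms.
Variables (F : fieldType) (V : lmodType F) (U : int -> V -> Prop).
Variables (f : seq V -> V) (a : V) (q : int).
Implicit Types (s : seq V) (ps : seq int).

(** Stated for a bare [f]: the merged operation satisfies these rules because it agrees with one of
    the two given structures in arities 2 and [n], long before its own Stasheff identities are
    available. *)
Record balanced n : Prop := Balanced {
  balanced_inner : forall s1 x y s2, (size s1 + size s2).+2 = n ->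
    homogeneous U (s1 ++ x :: a :: y :: s2) ->
    f (s1 ++ f [:: x; a] :: y :: s2) = f (s1 ++ x :: f [:: a; y] :: s2);
  balanced_right : forall s x, (size s).+1 = n ->
    homogeneous U (s ++ [:: x; a]) ->
    f (s ++ [:: f [:: x; a]]) = f [:: f (s ++ [:: x]); a];
  balanced_left : forall x s, (size s).+1 = n ->
    homogeneous U (a :: x :: s) ->
    f [:: a; f (x :: s)] = (-1) ^ ((2 - n%:Z) * q) *: f (f [:: a; x] :: s)
}.

Hypothesis f_lin : multilinear f.
Hypothesis f_deg : of_degree U (fun n => 2 - n%:Z) f.
Hypothesis Ua : U q a.

Let Ua_ex : exists p, U p a. Proof. by exists q. Qed.

Lemma stasheff_term_splitE ps s i t j psA psR A B C :
    ps = psA ++ psR -> s = A ++ B ++ C -> size psA = i -> size A = i -> size B = t ->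
  stasheff_term f ps s i t j =
  ((-1 : F) ^ ((i + j * t)%N%:Z + (2 - t%:Z) * \sum_(p <- psA) p)) *:
    f (A ++ f B :: C).
Proof. by move=> -> -> sz szA <-; rewrite -szA in sz *; apply: stasheff_term_split. Qed.

(** The neighbours between which [a] moves lie both before, both inside or both after the inner
    block, where one rule suffices, or they straddle one of its two edges, where a rule for the
    inner operation and one for the outer operation combine. *)
Lemma stasheff_term_balanced t u ps1 ps2 (p r : int) s1 x y s2 i j :
    balanced t -> balanced u -> (0 < t)%N ->
    (size s1 + size s2).+2 = (i + t + j)%N -> u = (i + j).+1 ->
    size ps1 = size s1 -> size ps2 = size s2 ->
    homogeneous U (s1 ++ x :: y :: s2) ->
  stasheff_term f (ps1 ++ p + q :: r :: ps2) (s1 ++ f [:: x; a] :: y :: s2) i t j =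
  stasheff_term f (ps1 ++ p :: q + r :: ps2) (s1 ++ x :: f [:: a; y] :: s2) i t j.
Proof.
move=> bal_t bal_u t_gt0 szN def_u szps1 szps2.
move=> /homogeneous_cat[hs1 /homogeneous_cons[hx /homogeneous_cons[hy hs2]]].
have hB B : (0 < size B)%N -> homogeneous U B -> exists p, U p (f B).
  by apply: homogeneous_degree f_deg.
case: (leqP (size s1).+2 i) => [le_ki|lt_ik].
  have [A2 [B [C [e2 szA2 szB]]]] : exists A2 B C,
      [/\ s2 = A2 ++ B ++ C, size A2 = (i - (size s1).+2)%N & size B = t].
    exists (take (i - (size s1).+2) s2), (take t (drop (i - (size s1).+2) s2)).
    exists (drop t (drop (i - (size s1).+2) s2)).
    by rewrite !cat_take_drop; split=> //; rewrite size_takel ?size_drop; lia.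
  have [pA [pR [ep szpA]]] : exists pA pR, ps2 = pA ++ pR /\ size pA = size A2.
    exists (take (size A2) ps2), (drop (size A2) ps2).
    by rewrite cat_take_drop size_takel // szps2 e2 size_cat leq_addr.
  rewrite (@stasheff_term_splitE _ _ _ _ _ (ps1 ++ p + q :: r :: pA) pR
    (s1 ++ f [:: x; a] :: y :: A2) B C) ?ep ?e2 -?catA ?size_cat //=; try lia.
  rewrite (@stasheff_term_splitE _ _ _ _ _ (ps1 ++ p :: q + r :: pA) pR
    (s1 ++ x :: f [:: a; y] :: A2) B C) -?catA ?size_cat //=; try lia.
  congr (_ ^ (_ + _ * _) *: _); first by rewrite !big_cat !big_cons /=; lia.
  move: hs2; rewrite e2 => /homogeneous_cat[hA2 /homogeneous_cat[hsB hsC]].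
  apply: (balanced_inner bal_u).
    move: szN; rewrite e2 !size_cat /= def_u; lia.
  apply/homogeneous_cat; split=> //; do 3!(apply/homogeneous_cons; split=> //).
  apply/homogeneous_cat; split=> //; apply/homogeneous_cons; split=> //.
  by apply: hB => //; rewrite szB.
case: (ltnP (size s1) i) => [lt_ki|le_ik].
  (* The block starts at [y]: the outer operation hands [a] from [x] to the inner value, and the
     inner operation then lets it in from the left. *)
  have def_i : i = (size s1).+1 by lia.
  have [B [C [e2 szB]]] : exists B C, s2 = B ++ C /\ size B = t.-1.
    exists (take t.-1 s2), (drop t.-1 s2); rewrite cat_take_drop; split=> //.
    by rewrite size_takel; lia.
  rewrite (@stasheff_term_splitE _ _ _ _ _ (ps1 ++ [:: p + q]) (r :: ps2)
    (s1 ++ [:: f [:: x; a]]) (y :: B) C) ?e2 -?catA ?size_cat //=; try lia.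
  rewrite (@stasheff_term_splitE _ _ _ _ _ (ps1 ++ [:: p]) (q + r :: ps2)
    (s1 ++ [:: x]) (f [:: a; y] :: B) C) ?e2 -?catA ?size_cat //=; try lia.
  move: hs2; rewrite e2 => /homogeneous_cat[hsB hsC].
  rewrite (balanced_inner bal_u).
  - rewrite (balanced_left bal_t); first last.
    + by do 2!(apply/homogeneous_cons; split=> //).
    + by rewrite szB prednK.
    rewrite -(cat_rcons x s1) multilinearZ // cat_rcons scalerA -sign_zD; congr (_ *: _).
    (* The degree $q$ no longer precedes the block, which accounts for one $(2-t)q$; [balanced_left]
       supplies the other, and the exponents differ by an even number. *)
    apply: (@eq_sign _ _ _ ((2 - t%:Z) * q)); rewrite !big_cat !big_seq1 /=; lia.
  - move: szN; rewrite e2 !size_cat; lia.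
  apply/homogeneous_cat; split=> //; do 3!(apply/homogeneous_cons; split=> //).
  by apply: hB => //; apply/homogeneous_cons.
have [A [B1 [e1 szA]]] : exists A B1, s1 = A ++ B1 /\ size A = i.
  by exists (take i s1), (drop i s1); rewrite cat_take_drop size_takel.
have [pA [pR [ep szpA]]] : exists pA pR, ps1 = pA ++ pR /\ size pA = i.
  by exists (take i ps1), (drop i ps1); rewrite cat_take_drop size_takel ?szps1.
move: hs1; rewrite e1 => /homogeneous_cat[hA hB1].
have szs1 : size s1 = (i + size B1)%N by rewrite e1 size_cat szA.
case: (ltnP (size s1).+1 (i + t)) => [lt_kit|le_itk].
  have [B2 [C [e2 szB]]] : exists B C, s2 = B ++ C /\ size B = (t - (size B1).+2)%N.
    exists (take (t - (size B1).+2) s2), (drop (t - (size B1).+2) s2).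
    rewrite cat_take_drop; split=> //; rewrite size_takel; lia.
  rewrite (@stasheff_term_splitE _ _ _ _ _ pA (pR ++ p + q :: r :: ps2)
    A (B1 ++ f [:: x; a] :: y :: B2) C) ?e2 ?ep -?catA ?size_cat //=; try lia.
  rewrite (@stasheff_term_splitE _ _ _ _ _ pA (pR ++ p :: q + r :: ps2)
    A (B1 ++ x :: f [:: a; y] :: B2) C) ?e2 -?catA ?size_cat //=; try lia.
  move: hs2; rewrite e2 => /homogeneous_cat[hB2 hC].
  rewrite (balanced_inner bal_t) //; first by lia.
  by apply/homogeneous_cat; split=> //; do 3!(apply/homogeneous_cons; split=> //).
case: (ltnP (size s1) (i + t)) => [lt_kit|le_itk'].
  (* The block ends at [x]: [a] leaves it on the right, and the outer operation hands it to [y]. *)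
  have szB1 : (size B1).+1 = t by lia.
  rewrite (@stasheff_term_splitE _ _ _ _ _ pA (pR ++ p + q :: r :: ps2)
    A (B1 ++ [:: f [:: x; a]]) (y :: s2)) ?ep -?catA ?size_cat ?addn1 //=.
  rewrite (@stasheff_term_splitE _ _ _ _ _ pA (pR ++ p :: q + r :: ps2)
    A (B1 ++ [:: x]) (f [:: a; y] :: s2)) -?catA ?size_cat ?addn1 //=.
  congr (_ *: _); rewrite (balanced_right bal_t) //.
    apply: (balanced_inner bal_u); first by lia.
    apply/homogeneous_cat; split=> //; apply/homogeneous_cons; split=> //.
      apply: hB; first by rewrite size_cat addn1.
      by apply/homogeneous_cat; split=> //; apply/homogeneous_cons; split.
    by do !(apply/homogeneous_cons; split=> //).
  by apply/homogeneous_cat; split=> //; do 2!(apply/homogeneous_cons; split=> //).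
have [B [C [eB szB]]] : exists B C, B1 = B ++ C /\ size B = t.
  by exists (take t B1), (drop t B1); rewrite cat_take_drop; split=> //; rewrite size_takel; lia.
rewrite (@stasheff_term_splitE _ _ _ _ _ pA (pR ++ p + q :: r :: ps2)
  A B (C ++ f [:: x; a] :: y :: s2)) ?ep ?eB -?catA //=.
rewrite (@stasheff_term_splitE _ _ _ _ _ pA (pR ++ p :: q + r :: ps2)
  A B (C ++ x :: f [:: a; y] :: s2)) -?catA //=.
move: hB1; rewrite eB => /homogeneous_cat[hsB hC].
congr (_ *: _); rewrite -!cat_cons !catA; apply: (balanced_inner bal_u).
  move: szs1; rewrite eB !size_cat /= => szs1; lia.
rewrite -catA; apply/homogeneous_cat; split=> //; apply/homogeneous_cons; split.
  by apply: hB => //; rewrite szB.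
apply/homogeneous_cat; split=> //; do 3!(apply/homogeneous_cons; split=> //).
Qed.

(** If the block is final ($j=0$), [a] leaves the inner and then the outer operation; otherwise only
    the outer one. No operation moves past [a] on its right, so no sign appears. *)
Lemma stasheff_term_balanced_last t u ps (p : int) s x i j :
    balanced t -> balanced u -> (0 < t)%N ->
    (size s).+1 = (i + t + j)%N -> u = (i + j).+1 ->
    size ps = size s -> homogeneous U (s ++ [:: x]) ->
  stasheff_term f (ps ++ [:: p + q]) (s ++ [:: f [:: x; a]]) i t j =
  f [:: stasheff_term f (ps ++ [:: p]) (s ++ [:: x]) i t j; a].
Proof.
move=> bal_t bal_u t_gt0 szN def_u szps /homogeneous_cat[hs /homogeneous_cons[hx _]].
have hB B : (0 < size B)%N -> homogeneous U B -> exists p, U p (f B).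
  by apply: homogeneous_degree f_deg.
have [A [B1 [e1 szA]]] : exists A B1, s = A ++ B1 /\ size A = i.
  by exists (take i s), (drop i s); rewrite cat_take_drop; split=> //; rewrite size_takel; lia.
have [pA [pR [ep szpA]]] : exists pA pR, ps = pA ++ pR /\ size pA = i.
  exists (take i ps), (drop i ps); rewrite cat_take_drop; split=> //.
  by rewrite size_takel ?szps; lia.
move: hs; rewrite e1 => /homogeneous_cat[hA hB1].
have szs : size s = (i + size B1)%N by rewrite e1 size_cat szA.
case: j => [|j] in szN def_u *.
  have szB1 : (size B1).+1 = t by lia.
  rewrite (@stasheff_term_splitE _ _ _ _ _ pA (pR ++ [:: p + q])
    A (B1 ++ [:: f [:: x; a]]) [::]) ?ep -?catA ?size_cat ?addn1 //=.
  rewrite (@stasheff_term_splitE _ _ _ _ _ pA (pR ++ [:: p])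
    A (B1 ++ [:: x]) [::]) -?catA ?size_cat ?addn1 //=.
  rewrite (multilinearZ [::]) //=; congr (_ *: _).
  rewrite (balanced_right bal_t) //.
    apply: (balanced_right bal_u); first by lia.
    apply/homogeneous_cat; split=> //; apply/homogeneous_cons; split=> //.
      apply: hB; first by rewrite size_cat addn1.
      by apply/homogeneous_cat; split=> //; apply/homogeneous_cons; split.
    by do !(apply/homogeneous_cons; split=> //).
  by apply/homogeneous_cat; split=> //; do 2!(apply/homogeneous_cons; split=> //).
have [B [C [eB szB]]] : exists B C, B1 = B ++ C /\ size B = t.
  by exists (take t B1), (drop t B1); rewrite cat_take_drop; split=> //; rewrite size_takel; lia.
rewrite (@stasheff_term_splitE _ _ _ _ _ pA (pR ++ [:: p + q])
  A B (C ++ [:: f [:: x; a]])) ?ep ?eB -?catA //=.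
rewrite (@stasheff_term_splitE _ _ _ _ _ pA (pR ++ [:: p])
  A B (C ++ [:: x])) -?catA //=.
move: hB1; rewrite eB => /homogeneous_cat[hsB hC].
rewrite (multilinearZ [::]) //=; congr (_ *: _).
rewrite -!cat_cons !catA; apply: (balanced_right bal_u).
  move: szs; rewrite eB !size_cat /= => szs; lia.
rewrite -catA; apply/homogeneous_cat; split=> //; apply/homogeneous_cons; split.
  by apply: hB => //; rewrite szB.
apply/homogeneous_cat; split=> //; do 2!(apply/homogeneous_cons; split=> //).
Qed.

End BalancedTerms.

(** * Subspaces, independence in a bigrading, and degrees modulo 3 *)

Section Misc.
Variables (F : fieldType) (V : lmodType F).

Lemma zero_subspace : subspace (@zero_space F V).
Proof. by split=> // a u v -> ->; rewrite scaler0 addr0. Qed.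

Lemma subspaceD (P : V -> Prop) u v : subspace P -> P u -> P v -> P (u + v).
Proof. by move=> [_ PD] Pu Pv; rewrite -[u]scale1r; apply: PD. Qed.

Lemma subspaceZ (P : V -> Prop) a u : subspace P -> P u -> P (a *: u).
Proof. by move=> [P0 PD] Pu; rewrite -[a *: u]addr0; apply: PD. Qed.

Lemma subspace_sum_space (I : eqType) (H : I -> V -> Prop) :
  (forall i, subspace (H i)) -> subspace (sum_space H).
Proof.
move=> H_sub; split; first by exists [::], (fun=> 0); rewrite big_nil.
move=> a _ _ [s [f [Hf ->]]] [t [g [Hg ->]]].
(* The index lists in [sum_space] may contain repetitions and may overlap. Over a duplicate-free
   list the terms with equal index are gathered into one vector of [H i]. *)
have collect (r r' : seq I) (h : I -> V) : {subset r <= r'} -> uniq r' ->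
    \sum_(i <- r') \sum_(j <- r | j == i) h j = \sum_(j <- r) h j.
  move=> rr' r'_uniq; rewrite (exchange_big_dep xpredT) //= big_seq [RHS]big_seq.
  apply: eq_bigr => j /rr' r'j; rewrite big_mkcond (bigD1_seq j) //= eqxx.
  by rewrite big1 ?addr0 // => i; rewrite eq_sym => /negPf ->.
pose r := undup (s ++ t).
have sr : {subset s <= r} by move=> i si; rewrite mem_undup mem_cat si.
have tr : {subset t <= r} by move=> i ti; rewrite mem_undup mem_cat ti orbT.
exists r, (fun i => a *: (\sum_(j <- s | j == i) f j) + \sum_(j <- t | j == i) g j).
split; last by rewrite big_split -scaler_sumr /= !collect ?undup_uniq.
have Hsum (s' : seq I) (h : I -> V) i : (forall j, j \in s' -> H j (h j)) ->
    H i (\sum_(j <- s' | j == i) h j).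
  move=> Hh; rewrite big_seq_cond; apply: big_ind => [|u v|j /andP[s'j /eqP <-]].
  - by case: (H_sub i).
  - exact: subspaceD.
  exact: Hh.
by move=> i _; apply: (proj2 (H_sub i)); apply: Hsum.
Qed.

Lemma prod_space_sub (mul : V -> V -> V) (P Q R : V -> Prop) v : subspace R ->
  (forall x y, P x -> Q y -> R (mul x y)) -> prod_space mul P Q v -> R v.
Proof.
move=> R_sub PQR [s [Ps ->]]; rewrite -(big_map (fun u => mul u.1 u.2) xpredT id).
by apply: subspace_sum => // _ /mapP[u /Ps[Pu Qu] ->]; apply: PQR.
Qed.

Lemma bigrading_disjoint (G : int -> int -> V -> Prop) i j v (js : seq int) g :
    bigrading G -> G i j v -> uniq js -> j \notin js ->
    (forall k, k \in js -> G i k (g k)) -> v = \sum_(k <- js) g k ->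
  v = 0.
Proof.
move=> [G_sub _ G_free] Gv js_uniq njs Gg def_v.
pose h (ij : int * int) := if ij.2 == j then v else - g ij.2.
have := G_free [seq (i, k) | k <- j :: js] h _ _ _ (i, j).
rewrite {3}/h eqxx; apply.
- by rewrite map_inj_uniq /= ?njs // => k l [].
- move=> _ /mapP[k jk ->]; rewrite /h /=; case: eqP => [-> //|nkj].
  rewrite -scaleN1r; apply: (@subspaceZ (G i k)); first exact: (G_sub (i, k)).
  by apply: Gg; move: jk; rewrite inE => /predU1P[].
- rewrite big_map big_cons {1}/h eqxx [X in X + _]def_v -big_split big_seq big1 //.
  move=> k jsk; rewrite /h /= ifF ?subrr //.
  by apply/eqP => kj; rewrite -kj jsk in njs.
by rewrite inE eqxx.
Qed.

Lemma Forall2_exists (S T : Type) (Q : S -> T -> Prop) (R : T -> V -> Prop) ss (s : seq V) :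
  List.Forall2 (fun p v => exists c, R c v /\ Q p c) ss s ->
  exists cs, List.Forall2 R cs s /\ List.Forall2 Q ss cs.
Proof.
elim=> [|p v {}ss {}s [c [Rv Qc]] _ [cs [Rs Qs]]].
  by exists [::]; split; constructor.
by exists (c :: cs); split; constructor.
Qed.

Lemma Forall2_mem_degree (U : int -> V -> Prop) s a q :
    homogeneous U s -> a \in s -> U q a ->
  exists ps, List.Forall2 U ps s /\ q \in ps.
Proof.
move=> hs + Ua; elim: s hs => // x s IHs /homogeneous_cons[[p Ux] hs].
rewrite inE => /predU1P[<-|/(IHs hs)[ps [Us qps]]].
  have [ps Us] := homogeneous_Forall2 hs; exists (q :: ps).
  by split; [constructor|exact: mem_head].
by exists (p :: ps); split; [constructor | rewrite inE qps orbT].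
Qed.

(* Degrees of E^[1], E^[2], E^[0] have weight 0, 1, 2; hypotheses (1) and (2) say
   that m_d and m_(d+1) vanish on arguments of total weight at least 2. *)
Definition weight (p : int) : nat := `|((p - 1) %% 3)%Z|%N.

(** Each degree is congruent to 1 plus its weight modulo 3; [z] collects the multiples of 3. *)
Lemma weight_sum (ps : seq int) : exists z : int,
  \sum_(p <- ps) p = (size ps)%:Z + (\sum_(p <- ps) weight p)%N%:Z + z * 3.
Proof.
elim: ps => [|p ps [z e]]; first by exists 0; rewrite !big_nil.
exists (z + ((p - 1) %/ 3)%Z); rewrite !big_cons /= e /weight; lia.
Qed.

Lemma ainf_balanced (U : int -> V -> Prop) one (f g : seq V -> V) n a q :
    (3 <= n)%N -> ainf_algebra U one f ->
    (forall s, (0 < size s)%N -> size s \notin [:: 2%N; n] -> f s = 0) ->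
    U q a -> (forall s, size s = n -> homogeneous U s -> a \in s -> f s = 0) ->
    (forall s, size s \in [:: 2%N; n] -> g s = f s) ->
  balanced U g a q n.
Proof.
move=> n_ge3 f_ainf f_single Ua f_a gf.
have g2 u v : g [:: u; v] = f [:: u; v] by apply: gf.
have gn s : size s = n -> g s = f s by move=> sz; apply: gf; rewrite sz !inE eqxx orbT.
split=> [s1 x y s2 sz hs|s x sz hs|x s sz hs].
- rewrite !g2 !gn ?size_cat /=; try lia.
  exact: (balanced_mid n_ge3 f_ainf f_single f_a).
- rewrite !g2 !gn ?size_cat /=; try lia.
  exact: (balanced_last n_ge3 f_ainf f_single f_a).
rewrite !g2 !gn //=; exact: (balanced_head n_ge3 f_ainf f_single Ua f_a).
Qed.

End Misc.

Definition piece_residue (c : piece) : nat :=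
  match c with P0 => 0 | P1 => 1 | P2d | P2d1 => 2 end.

Definition piece_weight (c : piece) : nat := weight (piece_residue c)%:Z.

(** * Lower degrees forced by generation from $E^1$, $E^2$, $E^3$ *)

Section Generation.
Variables (F : fieldType) (V : lmodType F) (E : int -> int -> V -> Prop).
Variables (one : V) (m : seq V -> V) (d : nat).
Hypothesis hE : bigraded_connected_algebra E one (binary m).
Hypothesis hE1 : same_space (upper E 1) (E 1 1).
Hypothesis hE2 : same_space (upper E 2) (add_space (E 2 d%:Z) (E 2 d.+1%:Z)).
Hypothesis hE3 : same_space (upper E 3) (E 3 (2 * d)%N%:Z).
Hypothesis hgen : forall n i : nat, (1 <= n)%N -> (1 <= i <= 3)%N ->
  same_space (upper E (3 * n + i)%N%:Z)
    (prod_space (binary m) (upper E i%:Z) (upper E (3 * n)%N%:Z)).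

Lemma bigrading_subspace i j : subspace (E i j).
Proof. by case: (bca_grading hE) => E_sub _ _; apply: (E_sub (i, j)). Qed.

Lemma upper_subspace i : subspace (upper E i).
Proof. by apply: subspace_sum_space => j; apply: bigrading_subspace. Qed.

Lemma mul_degree i j k l p q x y : p = i + k -> q = j + l ->
  E i j x -> E k l y -> E p q (m [:: x; y]).
Proof. by move=> -> ->; apply: bca_degree hE _ _ _ _ _ _. Qed.

(** Lower degrees add in products, so $E^{3n+3}=E^3E^{3n}$ inherits a single lower degree by
    induction. The two lemmas that follow multiply once more, by $E^1$ or $E^2$. *)
Lemma upper_3n n v : (0 < n)%N ->
  upper E (3 * n)%N%:Z v -> E (3 * n)%N%:Z (2 * d * n)%N%:Z v.
Proof.
elim: n v => // -[_ v _|n IHn v _]; first by rewrite !muln1 => /hE3.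
rewrite -[(3 * _)%N]/(3 * n.+2)%N mulnSr => /(@hgen n.+1 3 isT isT).
apply: prod_space_sub; first exact: bigrading_subspace.
move=> x y /hE3 Ex /IHn-/(_ isT) Ey; apply: mul_degree Ex Ey; lia.
Qed.

Lemma upper_3n1 n v : upper E (3 * n + 1)%N%:Z v ->
  E (3 * n + 1)%N%:Z (2 * d * n + 1)%N%:Z v.
Proof.
case: n => [|n]; first by rewrite !muln0 => /hE1.
move=> /(@hgen n.+1 1 isT isT); apply: prod_space_sub; first exact: bigrading_subspace.
move=> x y /hE1 Ex /upper_3n-/(_ isT) Ey; apply: mul_degree Ex Ey; lia.
Qed.

Lemma upper_3n2 n v : upper E (3 * n + 2)%N%:Z v ->
  add_space (E (3 * n + 2)%N%:Z (2 * d * n + d)%N%:Z)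
    (E (3 * n + 2)%N%:Z (2 * d * n + d.+1)%N%:Z) v.
Proof.
case: n => [|n]; first by rewrite !muln0 => /hE2.
set P := E _ _; set Q := E _ _.
have P_sub : subspace P by apply: bigrading_subspace.
have Q_sub : subspace Q by apply: bigrading_subspace.
move=> /(@hgen n.+1 2 isT isT); apply: prod_space_sub.
  split; first by exists 0, 0; rewrite addr0; split=> //; [case: P_sub|case: Q_sub].
  move=> a _ _ [u [w [Pu Qw ->]]] [u' [w' [Pu' Qw' ->]]].
  exists (a *: u + u'), (a *: w + w'); rewrite scalerDr addrACA; split=> //.
    by case: P_sub => _; apply.
  by case: Q_sub => _; apply.
move=> x y /hE2[u [w [Eu Ew ->]]] /upper_3n-/(_ isT) Ey.
exists (m [:: u; y]), (m [:: w; y]); split.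
- apply: mul_degree Eu Ey; lia.
- apply: mul_degree Ew Ey; lia.
by have := bca_linearl hE 1 u w y; rewrite !scale1r.
Qed.

(** Passes from upper degrees, in which weights are counted, to the pieces, in which the vanishing
    of $m_d$ and $m_{d+1}$ is assumed. Only degrees $3k+2$ really split. *)
Lemma upper_pieces p v : upper E p v ->
  sum_of (fun u => exists c, piece_space E d c u /\ weight p = piece_weight c) v.
Proof.
case: p => [n|n] Uv; last first.
  exists [::]; split=> //; rewrite big_nil.
  by have [|+ _] := @bca_nneg _ _ _ _ _ hE (Negz n) _ v; [|exact].
have [k [r [lt_r def_n]]] : exists k r, (r < 3)%N /\ n = (3 * k + r)%N.
  by exists (n %/ 3)%N, (n %% 3)%N; lia.
rewrite {n}def_n in Uv *.
have wE c : r = piece_residue c -> weight (3 * k + r)%N%:Z = piece_weight c.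
  by move=> ->; rewrite /piece_weight /weight; lia.
case: r => [|[|[|//]]] in lt_r Uv wE *.
- apply: sum_ofW; exists P0; split; last exact: wE.
  exact: (@sum_spaceW _ _ _ (fun k => upper E (3 * k + 0)%N%:Z) k).
- apply: sum_ofW; exists P1; split; last exact: wE.
  exact: (@sum_spaceW _ _ _ (fun k => upper E (3 * k + 1)%N%:Z) k).
have [u [w [Eu Ew ->]]] := upper_3n2 Uv.
exists [:: u; w]; rewrite big_cons big_seq1; split=> // x.
rewrite !inE => /orP[] /eqP ->; [exists P2d|exists P2d1]; split; try exact: wE.
  exact: (@sum_spaceW _ _ _ (fun k => E (3 * k + 2)%N%:Z (2 * d * k + d)%N%:Z) k).
exact: (@sum_spaceW _ _ _ (fun k => E (3 * k + 2)%N%:Z (2 * d * k + d.+1)%N%:Z) k).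
Qed.

(** A factor in $E^{[0]}$ may multiply any piece; it is between the other pieces that the lower
    degree decides which products vanish. *)
Definition piece_homogeneous (c : piece) (v : V) : Prop := exists k : nat,
  upper E (3 * k + piece_residue c)%N%:Z v /\
  match c with
  | P0 => True
  | P1 => E (3 * k + 1)%N%:Z (2 * d * k + 1)%N%:Z v
  | P2d => E (3 * k + 2)%N%:Z (2 * d * k + d)%N%:Z v
  | P2d1 => E (3 * k + 2)%N%:Z (2 * d * k + d.+1)%N%:Z v
  end.

Lemma piece_space_homogeneous c v :
  piece_space E d c v -> sum_of (piece_homogeneous c) v.
Proof.
case: c => /sum_space_sum_of/sum_of_bind; apply=> u [k Eu]; apply: sum_ofW; exists k;
  split=> //.
- exact: upper_3n1.
- exact: (sum_spaceW Eu).
- exact: (sum_spaceW Eu).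
Qed.

Lemma residue_space_upper r p z v : p = r%:Z + z * 3 -> (r < 3)%N ->
  upper E p v -> residue_space E r v.
Proof.
move=> def_p lt_r Uv; case: p => [n|n] in def_p Uv.
  apply: (@sum_spaceW _ _ _ (fun k => upper E (3 * k + r)%N%:Z) `|z|%N).
  by rewrite (_ : (3 * _ + r)%N = n) //; lia.
have [|+ _] := @bca_nneg _ _ _ _ _ hE (Negz n) _ v; first by [].
move=> /(_ Uv) ->.
by have [] : subspace (residue_space E r) by apply: subspace_sum_space => k; apply: upper_subspace.
Qed.

Hypothesis d_ge4 : (4 <= d)%N.

(** An element of $E^i$ in a lower degree other than those just computed would lie in independent
    summands at once, so it is 0. *)
Lemma collision1 k i j v : i = (3 * k + 1)%N%:Z -> j <> (2 * d * k + 1)%N%:Z ->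
  E i j v -> v = 0.
Proof.
move=> -> neq_j Ev; apply: (@bigrading_disjoint _ _ _ _ _ _
  [:: (2 * d * k + 1)%N%:Z] (fun=> v) (bca_grading hE) Ev) => //.
- by rewrite inE; apply/eqP.
- move=> l; rewrite inE => /eqP ->; exact: upper_3n1 (sum_spaceW Ev).
by rewrite big_seq1.
Qed.

Lemma collision0 k i j v : (0 < k)%N -> i = (3 * k)%N%:Z ->
  j <> (2 * d * k)%N%:Z -> E i j v -> v = 0.
Proof.
move=> k_gt0 -> neq_j Ev; apply: (@bigrading_disjoint _ _ _ _ _ _
  [:: (2 * d * k)%N%:Z] (fun=> v) (bca_grading hE) Ev) => //.
- by rewrite inE; apply/eqP.
- move=> l; rewrite inE => /eqP ->; exact: upper_3n (sum_spaceW Ev).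
by rewrite big_seq1.
Qed.

Lemma collision2 k i j v : i = (3 * k + 2)%N%:Z -> j <> (2 * d * k + d)%N%:Z ->
  j <> (2 * d * k + d.+1)%N%:Z -> E i j v -> v = 0.
Proof.
move=> -> neq_j neq_j' Ev; have [u [w [Eu Ew def_v]]] := upper_3n2 (sum_spaceW Ev).
apply: (@bigrading_disjoint _ _ _ _ _ _
  [:: (2 * d * k + d)%N%:Z; (2 * d * k + d.+1)%N%:Z]
  (fun l => if l == (2 * d * k + d)%N%:Z then u else w) (bca_grading hE) Ev).
- by rewrite /= inE andbT; lia.
- by rewrite !inE; lia.
- by move=> l; rewrite !inE => /orP[] /eqP ->; rewrite ?eqxx // ifF //; lia.
by rewrite big_cons big_seq1 eqxx ifF //; lia.
Qed.

(** Beyond multiples of $2d$, the excluded products have lower degree 2 against $d$ or $d+1$, $d+1$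
    or $d+2$ against $2d$, and $2d$ or $2d+2$ against $2d+1$; these never agree. *)
Lemma mul_pieces_eq0 c1 c2 x y :
    ~~ has (perm_eq [:: c1; c2])
      [:: [:: P0; P0]; [:: P0; P1]; [:: P2d; P2d1]; [:: P0; P2d]; [:: P0; P2d1]] ->
    piece_homogeneous c1 x -> piece_homogeneous c2 y ->
  m [:: x; y] = 0.
Proof.
have swap : perm_eq [:: c1; c2] =1 perm_eq [:: c2; c1].
  exact: (perm_catC [:: c1] [:: c2]).
(* The allowed pairs are listed in one order each. Keeping the condition for both orders lets
   [perm_refl] discard every allowed case. *)
move=> nc; have nc' := nc; rewrite (eq_has swap) in nc'.
move=> [k [_ Ex]] [l [_ Ey]]; move: nc nc' Ex Ey.
case: c1 c2 {swap} => [] []; rewrite /= ?perm_refl ?orbT // => _ _ Ex Ey;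
  have Exy := mul_degree erefl erefl Ex Ey.
- by apply: (collision2 (k := (k + l))) Exy; lia.
- by apply: (collision0 (k := (k + l).+1)) Exy; lia.
- by apply: (collision0 (k := (k + l).+1)) Exy; lia.
- by apply: (collision0 (k := (k + l).+1)) Exy; lia.
- by apply: (collision1 (k := (k + l).+1)) Exy; lia.
- by apply: (collision0 (k := (k + l).+1)) Exy; lia.
- by apply: (collision1 (k := (k + l).+1)) Exy; lia.
Qed.

End Generation.

(** * The merged multiplications and their Stasheff identities *)

Section Truncation.
Variables (F : fieldType) (V : lmodType F).
Variables (E : int -> int -> V -> Prop) (one : V) (m : seq V -> V) (d : nat).
Hypothesis hd : (4 <= d)%N.
Hypothesis hE : bigraded_connected_algebra E one (binary m).
Hypothesis hE1 : same_space (upper E 1) (E 1 1).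
Hypothesis hE2 : same_space (upper E 2) (add_space (E 2 d%:Z) (E 2 d.+1%:Z)).
Hypothesis hE3 : same_space (upper E 3) (E 3 (2 * d)%N%:Z).
Hypothesis hgen : forall n i : nat, (1 <= n)%N -> (1 <= i <= 3)%N ->
  same_space (upper E (3 * n + i)%N%:Z)
    (prod_space (binary m) (upper E i%:Z) (upper E (3 * n)%N%:Z)).
Hypothesis hsd : single_ainf d E one (only [:: 2%N; d] m).
Hypothesis hsd1 : single_ainf d.+1 E one (only [:: 2%N; d.+1] m).
Hypothesis h1 : acts_only_on E d m d [:: nseq d P1; rcons (nseq d.-1 P1) P2d1].
Hypothesis h2 : acts_only_on E d m d.+1 [:: nseq d.+1 P1; rcons (nseq d P1) P2d].

Let U := upper E.
Let M := only [:: 2%N; d; d.+1] m.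
Let Md := only [:: 2%N; d] m.
Let Md1 := only [:: 2%N; d.+1] m.

Let ainfd : ainf_algebra U one Md.
Proof. exact: bigraded_ainf_ainf (single_ainf_ainf hsd). Qed.

Let ainfd1 : ainf_algebra U one Md1.
Proof. exact: bigraded_ainf_ainf (single_ainf_ainf hsd1). Qed.

Lemma merge_d s : size s <> d.+1 -> M s = Md s.
Proof. by move=> /eqP/negPf ns; rewrite /M /Md /only !inE ns orbF. Qed.

Lemma merge_d1 s : size s <> d -> M s = Md1 s.
Proof. by move=> /eqP/negPf ns; rewrite /M /Md1 /only !inE ns. Qed.

Lemma merge_eq0 s : size s <> 2%N -> size s <> d -> size s <> d.+1 -> M s = 0.
Proof. by rewrite /M /only !inE => /eqP/negPf-> /eqP/negPf-> /eqP/negPf->. Qed.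

Lemma merge_m s : size s \in [:: 2%N; d; d.+1] -> M s = m s.
Proof. by rewrite /M /only => ->. Qed.

(** No arity equals both $d$ and $d+1$, so at each word [M] is one of the two given structures;
    properties checked word by word are inherited. *)
Lemma merge_case (P : seq V -> V -> Prop) :
  (forall s, size s <> d.+1 -> P s (Md s)) -> (forall s, size s <> d -> P s (Md1 s)) ->
  forall s, P s (M s).
Proof.
move=> Pd Pd1 s; case: (size s =P d.+1) => [sz|ns]; last by rewrite merge_d; auto.
have ns : size s <> d by lia.
by rewrite merge_d1; auto.
Qed.

Lemma multilinear_merge : multilinear M.
Proof.
move=> s1 s2 a u v.
have sz x : size (s1 ++ x :: s2) = (size s1 + size s2).+1 by rewrite size_cat addnS.
case: ((size s1 + size s2).+1 =P d.+1) => [e|ne].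
  by rewrite !merge_d1 ?sz ?e; try lia; apply: ainf_linear ainfd1 _ _ _ _ _.
by rewrite !merge_d ?sz //; apply: ainf_linear ainfd _ _ _ _ _.
Qed.

Lemma degree_merge : of_degree U (fun n => 2 - n%:Z) M.
Proof.
move=> ps s s_gt0 Us; move: (s) Us s_gt0; apply: (@merge_case (fun s v =>
  List.Forall2 U ps s -> (0 < size s)%N ->
  U (\sum_(p <- ps) p + (2 - (size s)%:Z)) v)) => {}s _ Us s_gt0.
  exact: (ainf_degree ainfd).
exact: (ainf_degree ainfd1).
Qed.

Lemma lower_merge : of_degree (lower E) (fun=> 0) M.
Proof.
move=> ps s s_gt0 Us; move: (s) Us s_gt0; apply: (@merge_case (fun s v =>
  List.Forall2 (lower E) ps s -> (0 < size s)%N ->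
  lower E (\sum_(p <- ps) p + 0) v)) => {}s _ Us s_gt0.
  exact: (bigraded_ainf_lower (single_ainf_ainf hsd) s_gt0 Us).
exact: (bigraded_ainf_lower (single_ainf_ainf hsd1) s_gt0 Us).
Qed.

Lemma unital_merge : strictly_unital one M.
Proof.
split=> [x|].
  by rewrite !merge_d /=; try lia; case: (ainf_unital ainfd).
apply: (@merge_case (fun s v => size s <> 2%N -> List.In one s -> v = 0)) => s _.
  by case: (ainf_unital ainfd) => _; apply.
by case: (ainf_unital ainfd1) => _; apply.
Qed.

Let U_pieces := upper_pieces hE hE2 hE3 hgen.

Lemma merge_weight ps s : List.Forall2 U ps s -> size s \in [:: d; d.+1] ->
  (1 < \sum_(p <- ps) weight p)%N -> M s = 0.
Proof.
move=> Us sz wt; rewrite -(Forall2_size Us) in sz.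
apply: (multilinear_closed multilinear_merge (@zero_subspace F V) U_pieces _ Us).
move=> s' /Forall2_exists[cs [Ecs wcs]].
have szs' := Forall2_size Ecs.
have [szcs ewt] : size ps = size cs /\
    (\sum_(p <- ps) weight p = \sum_(c <- cs) piece_weight c)%N.
  by elim: wcs => [|p c ? ? e _ [/= -> IH]]; rewrite ?big_nil // !big_cons e IH.
have pw1 : piece_weight P1 = 0%N by [].
have light n c : piece_weight c = 1%N ->
    (\sum_(c' <- rcons (nseq n P1) c) piece_weight c' <= 1)%N.
  by move=> e; rewrite -cats1 big_cat /= big_seq1 big_nseq e pw1 iter_addn_0 mul0n.
have light1 n : (\sum_(c' <- nseq n P1) piece_weight c' <= 1)%N.
  by rewrite big_nseq pw1 iter_addn_0 mul0n.
rewrite szcs szs' !inE in sz; rewrite ewt in wt.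
rewrite /zero_space merge_m ?inE ?sz ?orbT //.
case/orP: sz => /eqP sz; [apply: h1 Ecs _ => //|apply: h2 Ecs _ => //];
  by rewrite /= orbF; apply/negP => /orP[] /(perm_big _) e;
    move: wt; rewrite e ltnNge ?light ?light1 // (light1 d.+1).
Qed.

(** A single argument in $E^{3k}$ already has weight 2. *)
Lemma merge_3n s a k : U (3 * k)%N%:Z a -> size s \in [:: d; d.+1] ->
  homogeneous U s -> a \in s -> M s = 0.
Proof.
move=> Ua sz hs sa; have [ps [Us psk]] := Forall2_mem_degree hs sa Ua.
apply: merge_weight Us sz _.
rewrite (perm_big _ (perm_to_rem psk)) big_cons (_ : weight _ = 2%N) //.
by rewrite /weight; lia.
Qed.

Lemma merge_balanced k a n : U (3 * k)%N%:Z a -> n \in [:: d; d.+1] ->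
  balanced U M a (3 * k)%N%:Z n.
Proof.
move=> Ua; rewrite !inE => /orP[] /eqP ->.
  apply: (ainf_balanced (f := Md) _ ainfd _ Ua) => //; try lia.
  - by move=> s s_gt0 sz; apply: (single_zero hsd).
  - move=> s sz hs sa; rewrite -merge_d ?sz; last by lia.
    by apply: merge_3n Ua _ hs sa; rewrite sz inE eqxx.
  by move=> s; rewrite !inE => sz; apply: merge_d; lia.
apply: (ainf_balanced (f := Md1) _ ainfd1 _ Ua) => //; try lia.
- by move=> s s_gt0 sz; apply: (single_zero hsd1).
- move=> s sz hs sa; rewrite -merge_d1 ?sz; last by lia.
  by apply: merge_3n Ua _ hs sa; rewrite sz !inE eqxx orbT.
by move=> s; rewrite !inE => sz; apply: merge_d1; lia.
Qed.

(** Away from $2d$, a nonzero composite involving $m_{d+1}$ has arity $d+2$ or $2d+1$, and for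
    $d\ge4$ none involving $m_d$ does. So in those two arities [M] composes as [Md1], and in all
    others as [Md], term by term. *)
Lemma stasheff_merge_single ps s : List.Forall2 U ps s -> (0 < size s)%N ->
    size s <> (2 * d)%N ->
  \sum_(0 <= i < size s) \sum_(1 <= t < (size s - i).+1)
    stasheff_term M ps s i t (size s - i - t) = 0.
Proof.
move=> Us s_gt0 sz.
suff [f f_st eq_f] : exists2 f, stasheff U f & forall A B C,
    (size A + size B + size C)%N = size s -> M (A ++ M B :: C) = f (A ++ f B :: C).
  rewrite -[RHS](f_st ps s s_gt0 Us).
  apply: eq_big_nat => i lt_i; apply: eq_big_nat => t lt_t; congr (_ *: _).
  apply: eq_f; rewrite !size_takel ?size_drop; lia.
have M0 A C : M (A ++ 0 :: C) = 0 by apply: multilinear0 multilinear_merge.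
case: (boolP (size s \in [:: d.+2; (2 * d).+1])); rewrite !inE => szs.
  exists Md1; first exact: ainf_stasheff ainfd1.
  move=> A B C szABC.
  have szo x : (size (A ++ x :: C) + size B = (size s).+1)%N by rewrite size_cat /=; lia.
  have M10 : Md1 (A ++ 0 :: C) = 0 by apply: multilinear0 (ainf_linear ainfd1).
  case: (size B =P d) => [szB|nB].
    have := szo (M B); rewrite /Md1 {2}/only !inE szB => {}szo.
    rewrite ifF; last by lia.
    by rewrite -/Md1 M10 merge_eq0 //; lia.
  rewrite -(merge_d1 nB); case: (size (A ++ M B :: C) =P d) => [szo'|]; last exact: merge_d1.
  have {}szo := szo (M B).
  by rewrite [M B]merge_eq0 ?M0 ?M10 //; lia.
exists Md; first exact: ainf_stasheff ainfd.
move=> A B C szABC.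
have szo x : (size (A ++ x :: C) + size B = (size s).+1)%N by rewrite size_cat /=; lia.
have M10 : Md (A ++ 0 :: C) = 0 by apply: multilinear0 (ainf_linear ainfd).
case: (size B =P d.+1) => [szB|nB].
  have := szo (M B); rewrite /Md {2}/only !inE szB => {}szo.
  rewrite ifF; last by lia.
  by rewrite -/Md M10 merge_eq0 //; lia.
rewrite -(merge_d nB); case: (size (A ++ M B :: C) =P d.+1) => [szo'|]; last exact: merge_d.
have {}szo := szo (M B).
by rewrite [M B]merge_eq0 ?M0 ?M10 //; lia.
Qed.

(** An inner $m_2$ would leave an outer operation of arity $2d-1$, which is larger than $d+1$; every
    other inner arity gives 0 at once. *)
Lemma merge_term_eq0 ps s i t j : size s = (2 * d)%N -> (i + t <= 2 * d)%N ->
  (0 < t)%N -> t <> d -> t <> d.+1 -> stasheff_term M ps s i t j = 0.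
Proof.
move=> sz le_it t_gt0 td td1; rewrite /stasheff_term.
have szB : size (take t (drop i s)) = t by rewrite size_takel // size_drop; lia.
case: (t =P 2%N) => [t2|t2]; last first.
  by rewrite [M (take t _)]merge_eq0 ?szB // multilinear0 ?scaler0 //; apply: multilinear_merge.
rewrite merge_eq0 ?scaler0 // size_cat /= size_takel ?size_drop; lia.
Qed.

(** A block of weight at least 2 kills the inner value. Otherwise that value weighs 1 more than its
    block, so the outer arguments weigh 1 more than [ps], hence at least 2. *)
Lemma merge_term_weight ps s i t : List.Forall2 U ps s -> size s = (2 * d)%N ->
    t \in [:: d; d.+1] -> (i + t <= 2 * d)%N ->
    (0 < \sum_(p <- ps) weight p)%N ->
  stasheff_term M ps s i t (2 * d - i - t) = 0.
Proof.
move=> Us sz td le_it wt; rewrite /stasheff_term.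
set e := (_ ^ _); rewrite (_ : M (_ ++ _) = 0) ?scaler0 {e}//.
move: Us wt; rewrite -{1}[s](cat_take_drop i) -{1}[drop i s](cat_take_drop t)
  drop_drop [(t + i)%N]addnC.
have : size (take i s) = i by rewrite size_takel // sz; lia.
have : size (take t (drop i s)) = t by rewrite size_takel // size_drop sz; lia.
have : size (drop (i + t) s) = (2 * d - (i + t))%N by rewrite size_drop sz.
move: (take i s) (take t _) (drop (i + t) s) => A B C szC szB szA Us.
have [pA [pBC [UA /Forall2_cat_inv[pB [pC [UB UC ->]]] ->]]] := Forall2_cat_inv Us.
rewrite !big_cat /= => wt.
have [|wB] := ltnP 1 (\sum_(p <- pB) weight p).
  move=> wB; rewrite (merge_weight UB) ?szB //.
  by rewrite multilinear0 //; apply: multilinear_merge.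
have B_gt0 : (0 < size B)%N by move: td; rewrite szB !inE; lia.
have Uo := Forall2_cat UA (List.Forall2_cons _ _ (degree_merge B_gt0 UB) UC).
apply: (merge_weight Uo).
  move: td; rewrite size_cat /= !inE; lia.
have [z ez] := weight_sum pB.
rewrite big_cat big_cons /=; set w := weight (_ + _).
(* The block size cancels against the degree $2-t$ modulo 3. As the block has weight at most 1,
   adding 1 stays below 3 and the congruence is an equality. *)
have : w = (\sum_(p <- pB) weight p).+1.
  rewrite /w /weight ez (Forall2_size UB); move: wB.
  by move: (\sum_(p <- pB) weight p)%N => k; lia.
by move: wt wB w => /=; lia.
Qed.

Let stasheff_sum ps s := \sum_(0 <= i < 2 * d) \sum_(1 <= t < (2 * d - i).+1)
  stasheff_term M ps s i t (2 * d - i - t).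

Lemma multilinear_stasheff_sum ps : multilinear (stasheff_sum ps).
Proof.
move=> s1 s2 a u v; rewrite /stasheff_sum scaler_sumr -big_split; apply: eq_bigr => i _.
rewrite scaler_sumr -big_split; apply: eq_bigr => t _ /=.
exact: (multilinear_stasheff_term _ _ _ _ multilinear_merge).
Qed.

Lemma eq_stasheff_sum ps ps' s s' : size s = (2 * d)%N -> size s' = (2 * d)%N ->
    (forall i t u, t \in [:: d; d.+1] -> u \in [:: d; d.+1] -> (0 < t)%N ->
       (i + t <= 2 * d)%N -> u = (i + (2 * d - i - t)).+1 ->
       stasheff_term M ps s i t (2 * d - i - t) =
       stasheff_term M ps' s' i t (2 * d - i - t)) ->
  stasheff_sum ps s = stasheff_sum ps' s'.
Proof.
move=> sz sz' eq_t; apply: eq_big_nat => i lt_i; apply: eq_big_nat => t lt_t.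
have [td|] := boolP (t \in [:: d; d.+1]); last first.
  by rewrite !inE => td; rewrite !merge_term_eq0 //; lia.
by apply: (eq_t i t (2 * d - t).+1) => //; move: td; rewrite !inE; lia.
Qed.

Hypothesis hmix : forall s : seq V, size s = (2 * d)%N ->
  (forall x, x \in s -> upper E 1 x) ->
  \sum_(0 <= i < d) stasheff_term m (nseq (2 * d) 1) s i d.+1 (d.-1 - i) +
  \sum_(0 <= i < d.+1) stasheff_term m (nseq (2 * d) 1) s i d (d - i) = 0.

Lemma stasheff_sum_degree1 s : size s = (2 * d)%N -> (forall x, x \in s -> U 1 x) ->
  stasheff_sum (nseq (2 * d) 1) s = 0.
Proof.
move=> sz Us; rewrite -[RHS](hmix sz Us) /stasheff_sum (@sum_triangle_at2 _ _ _ _ d.+1 d); try lia.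
  have -> : (2 * d - d.+1).+1 = d by lia.
  have -> : (2 * d - d).+1 = d.+1 by lia.
  congr (_ + _); apply: eq_big_nat => i lt_i; rewrite /stasheff_term.
    have -> : (2 * d - i - d.+1 = d.-1 - i)%N by lia.
    have szB : size (take d.+1 (drop i s)) = d.+1 by rewrite size_takel // size_drop; lia.
    rewrite [M (take _ _)]merge_m ?szB ?inE ?eqxx ?orbT // [M (_ ++ _)]merge_m //.
    by rewrite size_cat /= size_takel ?size_drop ?inE sz; lia.
  have -> : (2 * d - i - d = d - i)%N by lia.
  have szB : size (take d (drop i s)) = d by rewrite size_takel // size_drop; lia.
  rewrite [M (take _ _)]merge_m ?szB ?inE ?eqxx ?orbT // [M (_ ++ _)]merge_m //.
  by rewrite size_cat /= size_takel ?size_drop ?inE sz; lia.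
by move=> i t le_it t_gt0 td1 td; apply: merge_term_eq0.
Qed.

Let merge_mul x y : M [:: x; y] = m [:: x; y].
Proof. by apply: merge_m; rewrite inE. Qed.

Lemma weight0_factor p x : U p x -> weight p = 0%N ->
  sum_of (fun u => (p = 1 /\ U 1 u) \/ exists k y a,
    [/\ (0 < k)%N, p = 1 + (3 * k)%N%:Z, U 1 y, U (3 * k)%N%:Z a & u = M [:: y; a]]) x.
Proof.
case: p => n Ux wp; last first.
  (* Negative degrees can also have weight 0; there $E^p=0$ and the empty sum serves. *)
  exists [::]; split=> //; rewrite big_nil.
  by have [|+ _] := @bca_nneg _ _ _ _ _ hE (Negz n) _ x; [|exact].
have [k def_n] : exists k, n = (3 * k + 1)%N.
  by exists (n %/ 3)%N; move: wp; rewrite /weight; lia.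
rewrite {n wp}def_n in Ux *.
case: k => [|k] in Ux *; first by apply: sum_ofW; left.
have /(_ x)[+ _] := @hgen k.+1 1 isT isT => /(_ Ux)[us [Uus ->]].
exists [seq M [:: u.1; u.2] | u <- us]; split; last first.
  by rewrite big_map; apply: eq_bigr => u _; rewrite merge_mul.
move=> _ /mapP[u /Uus[Uy Ua] ->]; right; exists k.+1, u.1, u.2; split=> //; lia.
Qed.

Lemma stasheff_sum_last k a ps (p : int) s x : U (3 * k)%N%:Z a -> (size s).+1 = (2 * d)%N ->
    size ps = size s -> homogeneous U (s ++ [:: x]) ->
  stasheff_sum (ps ++ [:: p + (3 * k)%N%:Z]) (s ++ [:: M [:: x; a]]) =
  M [:: stasheff_sum (ps ++ [:: p]) (s ++ [:: x]); a].
Proof.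
move=> Ua sz szps hs.
have mul_sum (r : seq nat) (G : nat -> V) :
    M [:: \sum_(i <- r) G i; a] = \sum_(i <- r) M [:: G i; a].
  rewrite -(big_map G xpredT id) -[RHS](big_map G xpredT (fun v => M [:: v; a])).
  exact: (multilinear_sum [::] [:: a] _ multilinear_merge).
rewrite /stasheff_sum mul_sum; apply: eq_big_nat => i lt_i.
rewrite mul_sum; apply: eq_big_nat => t lt_t.
have [td|] := boolP (t \in [:: d; d.+1]); last first.
  rewrite !inE => td; rewrite !merge_term_eq0 ?size_cat ?addn1 //; try lia.
  by rewrite (multilinear0 [::] [:: a] multilinear_merge).
apply: (stasheff_term_balanced_last multilinear_merge degree_merge Ua
  (u := (2 * d - t).+1)) => //; try lia;
  by apply: (merge_balanced Ua); move: td; rewrite !inE; lia.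
Qed.

(* Writing an argument of degree 3k + 1 as a product of E^1 and E^{3k}, the
   factor in E^{3k} is moved to the right, into the next argument, until it
   leaves the identity through the last one. *)
Lemma stasheff_sum_weight0 ps2 (s2 s1 : seq V) p x :
    List.Forall2 U (p :: ps2) (x :: s2) -> (forall y, y \in s1 -> U 1 y) ->
    (size s1 + size s2).+1 = (2 * d)%N ->
    (\sum_(q <- p :: ps2) weight q = 0)%N ->
  stasheff_sum (nseq (size s1) 1 ++ p :: ps2) (s1 ++ x :: s2) = 0.
Proof.
have nseqS n l : nseq n 1 ++ (1 : int) :: l = nseq n.+1 1 ++ l by elim: n => //= n ->.
elim: s2 ps2 s1 p x => [|z s2 IHs] ps2 s1 p x Us Us1 sz;
  inversion_clear Us as [|? ? ? ? Ux Us2]; rewrite big_cons => /eqP;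
  rewrite addn_eq0 => /andP[/eqP wp /eqP wps2];
  have [vs [Tvs ->]] := weight0_factor Ux wp;
  rewrite (multilinear_sum _ _ _ (multilinear_stasheff_sum _));
  (have Us1y y : U 1 y -> forall z', z' \in rcons s1 y -> U 1 z'
    by move=> Uy z'; rewrite mem_rcons inE => /predU1P[->|/Us1]);
  (have hs1 : homogeneous U s1 by move=> y /Us1 Uy; exists 1);
  apply: big1_seq => u /andP[_ /Tvs[[def_p Uu]|[k [y [a [k_gt0 def_p Uy Ua ->]]]]]].
- inversion_clear Us2; rewrite def_p nseqS cats0 addn0 in sz *.
  by rewrite sz; apply: stasheff_sum_degree1; rewrite cats1 ?size_rcons //; apply: Us1y.
- inversion_clear Us2; rewrite def_p addn0 in sz *.
  rewrite (@stasheff_sum_last k a _ _ _ _ Ua) ?size_nseq //; last first.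
    by apply/homogeneous_cat; split=> //; apply/homogeneous_cons; split; [exists 1|].
  rewrite nseqS cats0 sz stasheff_sum_degree1.
  + by rewrite (multilinear0 [::] [:: a] multilinear_merge).
  + by rewrite cats1 size_rcons.
  by rewrite cats1; apply: Us1y.
- rewrite def_p nseqS -cat_rcons -(size_rcons s1 u); inversion Us2; subst.
  by apply: IHs; [|apply: Us1y|rewrite size_rcons /= in sz *; lia|].
inversion Us2 as [|r z' ps2' s2' Ur Us2' e1 e2]; subst.
move: wps2 => /eqP; rewrite big_cons addn_eq0 => /andP[/eqP wr /eqP wps2'].
have {}sz : (size s1 + size s2).+2 = (2 * d)%N by move: sz; rewrite /= addnS.
have hs2 := Forall2_homogeneous Us2'; have szps2 := Forall2_size Us2'.
(* Absorbing [a] turns the degree [r] of [z] into [3k + r], again of weight 0, and [y] joins the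
   arguments of degree 1: the induction on [s2] applies to the new word. *)
rewrite (@eq_stasheff_sum _ (nseq (size s1) 1 ++ 1 :: (3 * k)%N%:Z + r :: ps2') _
  (s1 ++ y :: M [:: a; z] :: s2)); rewrite ?size_cat /= ?addnS //.
  rewrite nseqS -cat_rcons -(size_rcons s1 y); apply: IHs.
  - constructor=> //.
    have := degree_merge (s := [:: a; z]) isT
      (List.Forall2_cons _ _ Ua (List.Forall2_cons _ _ Ur (List.Forall2_nil _))).
    by rewrite !big_cons big_nil (_ : 2 - _ = 0) ?addr0.
  - exact: Us1y.
  - by rewrite size_rcons; lia.
  by rewrite big_cons wps2' addn0; move: wr; rewrite /weight; lia.
move=> i t n td nd t_gt0 le_it def_n.
apply: (stasheff_term_balanced multilinear_merge degree_merge Ua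
  (u := n)) => //; rewrite ?size_nseq //; try exact: (merge_balanced Ua).
  by rewrite sz; lia.
apply/homogeneous_cat; split=> //; apply/homogeneous_cons; split; first by exists 1.
by apply/homogeneous_cons; split; first by exists r.
Qed.

Lemma merge_stasheff : stasheff U M.
Proof.
move=> ps s s_gt0 Us.
case: (size s =P (2 * d)%N) => [sz|]; last exact: stasheff_merge_single.
rewrite sz; case: (posnP (\sum_(p <- ps) weight p)%N) => [w0|wt].
  case: Us s_gt0 sz w0 => [//|p x ps' s' Ux Us' _ sz w0].
  by apply: (@stasheff_sum_weight0 ps' s' [::] p x) => //; constructor.
rewrite big_nat big1 // => i lt_i; rewrite big_nat big1 // => t lt_t.
have [td|] := boolP (t \in [:: d; d.+1]).
  by apply: merge_term_weight Us sz td _ wt; lia.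
by rewrite !inE => td; apply: merge_term_eq0; lia.
Qed.

Lemma merge_bigraded_ainf : bigraded_ainf E one M.
Proof.
split; [exact: bca_grading hE| |exact: lower_merge].
split; [by case: ainfd|exact: multilinear_merge|exact: degree_merge| |].
  exact: merge_stasheff.
exact: unital_merge.
Qed.

Lemma merge_vanish n : (0 < n)%N ->
  acts_only_on E d M n (unzip1 (truncated_rules d)).
Proof.
move=> n_gt0 cs s sz Es nw.
have not_has ws : {subset ws <= unzip1 (truncated_rules d)} -> ~~ has (perm_eq cs) ws.
  by move=> ws_sub; apply: contra nw => /hasP[w /ws_sub ws_w csw]; apply/hasP; exists w.
case: (n =P d) => [nd|nd].
  rewrite merge_m ?sz ?nd ?inE ?eqxx ?orbT //; apply: h1 Es _; rewrite ?sz //.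
  by apply: not_has => w; rewrite !inE => /orP[] /eqP ->; rewrite eqxx ?orbT.
case: (n =P d.+1) => [nd1|nd1].
  rewrite merge_m ?sz ?nd1 ?inE ?eqxx ?orbT //; apply: h2 Es _; rewrite ?sz //.
  by apply: not_has => w; rewrite !inE => /orP[] /eqP ->; rewrite eqxx ?orbT.
case: (n =P 2%N) => [n2|n2]; last by rewrite merge_eq0 ?sz.
apply: (multilinear_closed multilinear_merge (@zero_subspace F V)
  (piece_space_homogeneous hE hE1 hE3 hgen) _ Es) => s' Es'.
have := Forall2_size Es'; rewrite (Forall2_size Es) sz n2.
case: Es' not_has => // c1 x cs1 s1 Ex [//|c2 y cs2 s2 Ey [|//]] not_has _.
rewrite /zero_space merge_mul; apply: (mul_pieces_eq0 hE hE1 hE2 hE3 hgen hd) Ex Ey.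
by apply: not_has => w; rewrite !inE => /or4P[||| /orP[]] /eqP ->; rewrite eqxx ?orbT.
Qed.

(** A pure degree count: for each rule, the residues of the pieces plus $2-n$ give [r] modulo 3, the
    quotient being the witness 0 or 1. *)
Lemma merge_values w r cs s : (w, r) \in truncated_rules d ->
  perm_eq cs w -> List.Forall2 (piece_space E d) cs s -> residue_space E r (M s).
Proof.
move=> wr csw Es.
have r_sub : subspace (residue_space E r).
  by apply: subspace_sum_space => k; apply: (upper_subspace hE).
apply: (multilinear_closed multilinear_merge r_sub
  (piece_space_homogeneous hE hE1 hE3 hgen) _ Es) => s' Es'.
have [ps [Us' [z ez]]] : exists ps, List.Forall2 U ps s' /\ exists z : int,
    \sum_(p <- ps) p = (\sum_(c <- cs) piece_residue c)%N%:Z + z * 3.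
  elim: Es' => [|c x cs' {}s' [k [Ux _]] _ [ps [Us' [z ez]]]].
    by exists [::]; split; [constructor|exists 0; rewrite !big_nil].
  exists ((3 * k + piece_residue c)%N%:Z :: ps); split; first by constructor.
  exists (k%:Z + z); rewrite !big_cons ez.
  by move: (\sum_(c <- _) piece_residue c)%N => n; lia.
have szs' : size s' = size w by rewrite -(Forall2_size Es') (perm_size csw).
have [z' [lt_r w_gt0 ew]] : exists z' : int, [/\ (r < 3)%N, (0 < size w)%N &
    (\sum_(c <- w) piece_residue c)%N%:Z + 2 - (size w)%:Z = r%:Z + z' * 3].
  have sum1 n : (\sum_(c <- nseq n P1) piece_residue c = n)%N.
    by rewrite big_nseq iter_addn_0 mul1n.
  have sum2 n c : (\sum_(c' <- rcons (nseq n P1) c) piece_residue c' = n + piece_residue c)%N.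
    by rewrite -cats1 big_cat /= big_seq1 sum1.
  move: wr; rewrite !inE => /orP[|/orP[|/orP[|/orP[|/orP[|/orP[|/orP[|/orP[]]]]]]]]
    /eqP[-> ->]; rewrite ?sum1 ?sum2 ?(sum1 d.+1) ?size_rcons ?size_nseq ?big_cons ?big_nil.
  - by exists 0.
  - by exists 0.
  - by exists 1.
  - by exists 0.
  - by exists 0.
  - by exists 1; split=> //=; lia.
  - by exists 0; split=> //=; lia.
  - by exists 1; split=> //=; lia.
  - by exists 0; split=> //=; rewrite size_nseq; lia.
apply: (residue_space_upper hE (p := \sum_(p <- ps) p + (2 - (size s')%:Z)) (z := z + z')) => //.
  have e : (\sum_(c <- cs) piece_residue c = \sum_(c <- w) piece_residue c)%N.
    exact: perm_big.
  by rewrite szs' ez e; move: ew; move: (\sum_(c <- w) _)%N => n; lia.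
by apply: degree_merge; rewrite ?szs'.
Qed.

End Truncation.

Unset Implicit Arguments.

Theorem proposition2p14 (F : fieldType) (V : lmodType F)
    (E : int -> int -> V -> Prop) (one : V) (m : seq V -> V) (d : nat)
    (hd : (4 <= d)%N)
    (hE : bigraded_connected_algebra E one (binary m))
    (hE1 : same_space (upper E 1) (E 1 1))
    (hE2 : same_space (upper E 2) (add_space (E 2 d%:Z) (E 2 d.+1%:Z)))
    (hE3 : same_space (upper E 3) (E 3 (2 * d)%N%:Z))
    (hgen : forall n i : nat, (1 <= n)%N -> (1 <= i <= 3)%N ->
      same_space (upper E (3 * n + i)%N%:Z)
        (prod_space (binary m) (upper E i%:Z) (upper E (3 * n)%N%:Z)) /\
      same_space (upper E (3 * n + i)%N%:Z)
        (prod_space (binary m) (upper E (3 * n)%N%:Z) (upper E i%:Z)))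
    (hsd : single_ainf d E one (only [:: 2%N; d] m))
    (hsd1 : single_ainf d.+1 E one (only [:: 2%N; d.+1] m))
    (h1 : acts_only_on E d m d [:: nseq d P1; rcons (nseq d.-1 P1) P2d1])
    (h2 : acts_only_on E d m d.+1 [:: nseq d.+1 P1; rcons (nseq d P1) P2d])
    (hmix : forall s : seq V, size s = (2 * d)%N ->
      (forall x, x \in s -> upper E 1 x) ->
      \sum_(0 <= i < d)
         stasheff_term m (nseq (2 * d) 1) s i d.+1 (d.-1 - i) +
      \sum_(0 <= i < d.+1)
         stasheff_term m (nseq (2 * d) 1) s i d (d - i) = 0) :
  truncated_ainf d E one (only [:: 2%N; d; d.+1] m).
Proof.
have hgen' n i n_gt0 lt_i := proj1 (hgen n i n_gt0 lt_i).
split.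
- exact: (merge_bigraded_ainf hd hE hE2 hE3 hgen' hsd hsd1 h1 h2 hmix).
- by move=> s _; rewrite /only => /negPf ->.
- exact: (merge_vanish hd hE hE1 hE2 hE3 hgen' hsd hsd1 h1 h2).
- exact: (merge_values hd hE hE1 hE3 hgen' hsd hsd1).
Qed.
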